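(* Let $X$ be a locally finite tree and let $\gamma_1,\gamma_2\in\mathrm{Aut}(X)$ be hyperbolic automorphisms with translation lengths $m_1\ge m_2>0$ and axes $A_{\gamma_1},A_{\gamma_2}$, such that $\Gamma=\langle\gamma_1,\gamma_2\rangle$ is discrete and acts without inversions. Let $l=\ell(A_{\gamma_1}\cap A_{\gamma_2})$ be the length of the intersection of the axes ($l=0$ if the axes share no edge). If the axes share an edge, suppose that $A_{\gamma_1}\cap A_{\gamma_2}$ is a finite path $[v^-,v^+]$ and that both $\gamma_1$ and $\gamma_2$ translate from $v^-$ toward $v^+$ along it. Let $\{m_i\}_{i=1}^{k+1}$, $\{q_i\}_{i=1}^{k-1}$, $\{\gamma_i\}_{i=1}^{k+1}$ be defined inductively, as long as $m_{i+1}>0$, by $$q_i=\left\lfloor \frac{m_i}{m_{i+1}}\right\rfloor,\qquad m_{i+2}=m_i-q_im_{i+1},\qquad \gamma_{i+2}=\gamma_i\gamma_{i+1}^{-q_i},$$ where $k$ is the index with $m_{k+1}=0$ (so $m_k=\gcd(m_1,m_2)$). Then $\Gamma$ falls into exactly one of the cases (1)-(3) below. (1) If $l=0$, then $\Gamma$ is free of rank two; there is a Schottky pair of generators $(\gamma_{\mathrm a},\gamma_{\mathrm b})$ of $\Gamma$ whose axes have disjoint edges. (2) If $0<l\le m_1+m_2-\gcd(m_1,m_2)$, there are unique integers $j,q$ with $$(m_1+m_2)-m_j+(q-1)m_{j+1}<l\le (m_1+m_2)-m_j+qm_{j+1},\quad 1\le j\le k-1,\quad 0\le q\le q_j-1.$$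 (2a) If $l=(m_1+m_2)-m_j+qm_{j+1}$, then $\gamma_j\gamma_{j+1}^{-q}$ is hyperbolic; set $l_0=\ell\big(A_{\gamma_j\gamma_{j+1}^{-q}}\cap\gamma_{j+1}.A_{\gamma_j\gamma_{j+1}^{-q}}\big)$. (2a)(i) If $l_0\ge \frac{m_j-(q+1)m_{j+1}}{2}$, then $\Gamma$ is not free: it is generated by a hyperbolic element $\gamma_{\mathrm a}$ and an elliptic element $\gamma_{\mathrm b}$, and the axis $A_{\gamma_{\mathrm a}}$ and the fixed subtree $T_{\gamma_{\mathrm b}}$ are disjoint. (2a)(ii) If $l_0<\frac{m_j-(q+1)m_{j+1}}{2}$, then $\Gamma$ is free of rank two: there is a Schottky pair $(\gamma_{\mathrm a},\gamma_{\mathrm b})$ generating $\Gamma$ whose axes $A_{\gamma_{\mathrm a}}$ and $A_{\gamma_{\mathrm b}}$ are disjoint. (2b) If $l<(m_1+m_2)-m_j+qm_{j+1}$, then $\Gamma$ is free of rank two: there is a Schottky pair $(\gamma_{\mathrm a},\gamma_{\mathrm b})$ generating $\Gamma$ whose axes $A_{\gamma_{\mathrm a}}$ and $A_{\gamma_{\mathrm b}}$ intersect (sharing an edge) with $v^+$ as an endpoint of the intersection. (3) If $l>m_1+m_2-\gcd(m_1,m_2)$, then $\Gamma$ is not free: it is generated by a hyperbolic element $\gamma_{\mathrm a}$ and an elliptic element $\gamma_{\mathrm b}$, and the axis $A_{\gamma_{\mathrm a}}$ and the fixed subtree $T_{\gamma_{\mathrm b}}$ intersect (sharing an edge) with $v^+$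 as an endpoint of the intersection.
   Context: A tree is a connected acyclic simple graph; $d$ is the combinatorial distance on vertices and $\ell$ denotes the number of edges of a path (possibly $\infty$). An automorphism $g$ of $X$ is elliptic if it fixes a vertex, an inversion if it preserves but flips an edge, and hyperbolic otherwise. If $g$ is elliptic, $T_g$ is the subtree of fixed points. If $g$ is hyperbolic, its translation length is $m_g=\min_v d(v,g.v)\in\mathbb N_{>0}$, attained exactly on the vertices of a bi-infinite geodesic $A_g$, the axis of $g$, along which $g$ translates by $m_g$. A subgroup $G<\mathrm{Aut}(X)$ is discrete if there is a finite subtree $T\subset X$ such that the only element of $G$ fixing every vertex of $T$ is the identity. Convention: two axes (or an axis and a fixed subtree) are called disjoint if they share no edge, even though they may meet at a vertex. Schottky pair: a pair $(g_1,g_2)$ of hyperbolic automorphisms such that there are four edges $e_1^+,e_1^-,e_2^+,e_2^-$ with $g_i.e_i^-=e_i^+$, and for each of these edges a connected component $H_i^{\pm}$ of $X\setminus\{e_i^{\pm}\}$ (open edge removed), such that the four subtrees $H_i^\pm$ are non-empty and pairwise disjoint and $$g_i.(X\setminus H_i^-)=e_i^+\cup H_i^+,\qquad g_i^{-1}.(X\setminus H_i^+)=e_i^-\cup H_i^-,\qquad i=1,2.$$ *)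

(* Defs.v *)
From HB Require Import structures.
From mathcomp Require Import all_boot all_order all_algebra finmap.
From mathcomp Require Import boolp classical_sets functions cardinality.
From mathcomp Require Import constructive_ereal.

Set Implicit Arguments.
Unset Strict Implicit.
Unset Printing Implicit Defensive.

Local Open Scope classical_set_scope.
Local Open Scope group_scope.

Definition nat_min (P : set nat) : nat :=
  xget 0%N [set n | P n /\ forall i, P i -> (n <= i)%N].

Definition exactly_one_of_three (P Q R : Prop) : Prop :=
  [\/ [/\ P, ~ Q & ~ R], [/\ ~ P, Q & ~ R] | [/\ ~ P, ~ Q & R]].

Definition generated (G : groupType) (S : set G) : set G :=
  smallest [set H : set G | group_closed (mem H)] S.

(* A word is a sequence of letters (s, b), which stands for s if b is true
   and for s^-1 if b is false. *)
Definition word_eval (G : groupType) (w : seq (G * bool)) : G :=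
  \prod_(u <- w) (if u.2 then u.1 else u.1^-1).

Definition reduced_word (G : groupType) (w : seq (G * bool)) : bool :=
  sorted (fun u v => ~~ ((u.1 == v.1) && (u.2 != v.2))) w.

Definition free_basis (G : groupType) (S H : set G) : Prop :=
  H = generated S /\
  forall w : seq (G * bool), w <> [::] -> (forall u, u \in w -> S u.1) ->
    reduced_word w -> word_eval w <> 1.

Definition is_free (G : groupType) (H : set G) : Prop :=
  exists S : set G, free_basis S H.

Definition is_free_of_rank (G : groupType) (n : nat) (H : set G) : Prop :=
  exists S : set G, (S #= `I_n)%card /\ free_basis S H.

Record tree := Tree {
  vertex :> choiceType;
  adj : rel vertex;
  adj_sym : symmetric adj;
  adj_irr : irreflexive adj;
  tree_nonempty : inhabited vertex;
  tree_connected : forall x y, exists p, path adj x p /\ last x p = y;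
  tree_acyclic : forall c, ucycle adj c -> (size c <= 2)%N
}.

Definition locally_finite (X : tree) : Prop :=
  forall x : X, finite_set [set y | adj x y].

Definition dist (X : tree) (x y : X) : nat :=
  nat_min [set size p | p in [set p | path (@adj X) x p /\ last x p = y]].

Definition segment (X : tree) (x y : X) : set X :=
  [set z | (dist x z + dist z y)%N = dist x y].

Definition is_subtree (X : tree) (T : set X) : Prop :=
  T !=set0 /\
  forall x y, T x -> T y ->
    exists p, [/\ path (@adj X) x p, last x p = y & forall z, z \in p -> T z].

(* An edge is identified with the pair of its endpoints, and a subtree of X
   (an axis, a fixed subtree, an intersection of such) with its vertex set. *)
Definition edges (X : tree) (A : set X) : set (set X) :=
  [set e | exists x y, [/\ A x, A y, adj x y & e = [set x; y]]].

Definition edge_disjoint (X : tree) (A B : set X) : Prop :=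
  edges A `&` edges B = set0.

(* number of edges, possibly infinite *)
Definition ell (X : tree) (A : set X) : \bar rat :=
  if `[< finite_set (edges A) >] then ((#|` fset_set (edges A)|)%:R)%:E%R
  else +oo%E.

(* v is an endpoint of the path A, which has at least one edge *)
Definition endpoint (X : tree) (v : X) (A : set X) : Prop :=
  A v /\ exists! w, A w /\ adj v w.

(* vertex set of a connected component of X with the open edge e removed *)
Definition component_minus_edge (X : tree) (e H : set X) : Prop :=
  exists x, H = [set y | exists p,
    path (fun u v => adj u v && ([set u; v] != e)) x p /\ last x p = y].

Record aut (X : tree) := Aut {
  aut_fun :> X -> X;
  aut_inv : X -> X;
  aut_funK : cancel aut_fun aut_inv;
  aut_invK : cancel aut_inv aut_fun;
  aut_adj : forall x y, adj (aut_fun x) (aut_fun y) = adj x y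
}.

Lemma aut_ext (X : tree) (g h : aut X) : g =1 h -> g = h.
Proof.
case: g h => [f f' fK f'K fA] [h h' hK h'K hA] /= fh.
have {fh} E : f = h by apply: funext.
have E' : f' = h'.
  by apply: funext => x; rewrite -[x in LHS]h'K -E fK.
subst h h'; congr Aut; exact: Prop_irrelevance.
Qed.

Section AutGroup.
Variable X : tree.
Implicit Types g h : aut X.

HB.instance Definition _ := gen_eqMixin (aut X).
HB.instance Definition _ := gen_choiceMixin (aut X).

Definition aut_one : aut X :=
  @Aut X id id (fun=> erefl) (fun=> erefl) (fun _ _ => erefl).

Fact aut_inv_adj g x y : adj (aut_inv g x) (aut_inv g y) = adj x y.
Proof. by rewrite -(aut_adj g) !aut_invK. Qed.

Definition aut_opp g : aut X :=
  Aut (aut_invK g) (aut_funK g) (aut_inv_adj g).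

Fact aut_mul_adj g h x y : adj ((g \o h) x) ((g \o h) y) = adj x y.
Proof. by rewrite /= !aut_adj. Qed.

(* Left action: (g * h) x = g (h x). *)
Definition aut_mul g h : aut X :=
  Aut (can_comp (aut_funK g) (aut_funK h))
      (can_comp (aut_invK h) (aut_invK g)) (aut_mul_adj g h).

Fact aut_mulA : associative aut_mul.
Proof. by move=> f g h; apply: aut_ext. Qed.
Fact aut_mul1 : left_id aut_one aut_mul.
Proof. by move=> g; apply: aut_ext. Qed.
Fact aut_1mul : right_id aut_one aut_mul.
Proof. by move=> g; apply: aut_ext. Qed.
Fact aut_mulV : left_inverse aut_one aut_opp aut_mul.
Proof. by move=> g; apply: aut_ext => x /=; rewrite aut_funK. Qed.
Fact aut_Vmul : right_inverse aut_one aut_opp aut_mul.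
Proof. by move=> g; apply: aut_ext => x /=; rewrite aut_invK. Qed.

HB.instance Definition _ :=
  isGroup.Build (aut X) aut_mulA aut_mul1 aut_1mul aut_mulV aut_Vmul.

End AutGroup.

Definition elliptic (X : tree) (g : aut X) : Prop := exists x, g x = x.

Definition inversion (X : tree) (g : aut X) : Prop :=
  exists x y, [/\ adj x y, g x = y & g y = x].

Definition hyperbolic (X : tree) (g : aut X) : Prop :=
  ~ elliptic g /\ ~ inversion g.

Definition fixed_subtree (X : tree) (g : aut X) : set X := [set x | g x = x].

Definition translation_length (X : tree) (g : aut X) : nat :=
  nat_min [set dist x (g x) | x in [set: X]].

Definition axis (X : tree) (g : aut X) : set X :=
  [set x | dist x (g x) = translation_length g].

(* For x on the axis of the hyperbolic automorphism g, the union of the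
   segments [x, g^n x] is the ray of the axis issued from x in the direction of
   the translation. *)
Definition translates_toward (X : tree) (g : aut X) (x y : X) : Prop :=
  exists n, segment x ((g ^+ n) x) y.

Definition discrete (X : tree) (G : set (aut X)) : Prop :=
  exists T : set X, [/\ finite_set T, is_subtree T &
    forall g, G g -> (forall x, T x -> g x = x) -> g = 1].

Definition without_inversions (X : tree) (G : set (aut X)) : Prop :=
  forall g, G g -> ~ inversion g.

(* In g.(X \ Hm) = ep U Hp the edge ep is open: X \ Hm consists of the open edge
   em and of the other component of X \ em.  Given g.em = ep, the equality thus
   amounts to the one below between vertex sets. *)
Definition schottky_data (X : tree) (g : aut X) (ep em Hp Hm : set X) : Prop :=
  [/\ edges [set: X] ep, edges [set: X] em & g @` em = ep] /\
  [/\ component_minus_edge ep Hp, component_minus_edge em Hm,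
      g @` (~` Hm) = Hp & aut_inv g @` (~` Hp) = Hm].

Definition schottky_pair (X : tree) (g1 g2 : aut X) : Prop :=
  [/\ hyperbolic g1, hyperbolic g2 &
    exists (e1p e1m e2p e2m : set X) (H1p H1m H2p H2m : set X),
    [/\ schottky_data g1 e1p e1m H1p H1m,
        schottky_data g2 e2p e2m H2p H2m,
        [/\ H1p !=set0, H1m !=set0, H2p !=set0 & H2m !=set0],
        [/\ H1p `&` H1m = set0, H1p `&` H2p = set0 & H1p `&` H2m = set0] &
        [/\ H1m `&` H2p = set0, H1m `&` H2m = set0 & H2p `&` H2m = set0]]].

(* All sequences are indexed from 1; their values at the other indices are
   irrelevant. *)
Definition euclidean_sequences (X : tree) (k : nat) (m qs : nat -> nat)
    (gam : nat -> aut X) : Prop :=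
  [/\ forall i, (1 <= i <= k)%N -> (0 < m i)%N,
      m k.+1 = 0%N &
      forall i, (1 <= i <= k.-1)%N ->
        [/\ qs i = (m i %/ m i.+1)%N,
            m i.+2 = (m i - qs i * m i.+1)%N &
            gam i.+2 = gam i * gam i.+1 ^- qs i]].

(* Main.v *)
Require Import Defs.
From mathcomp Require Import all_boot all_order all_algebra.
From mathcomp Require Import boolp classical_sets functions cardinality.
From mathcomp Require Import constructive_ereal.
From mathcomp Require Import finmap zify lra.

Set Implicit Arguments.
Unset Strict Implicit.
Unset Printing Implicit Defensive.

(* Let D = m_1 + m_2 - l.  If both translation lengths and the overlap L of the
   axes satisfy N < M and N < L, then replacing (a, b) by (a b^-1, b) turns
   (M, N, L) into (M - N, N, L - N): D does not change and v+ remains an endpoint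
   of the overlap.  So the Euclidean algorithm runs on the pair of generators
   until L <= N <= M, or L > N = M.  The pair with M = m_j - q m_{j+1} and
   N = m_{j+1} is reached with 0 < L <= N exactly when M <= D < M + N, which is
   the window of (j, q).

   - If L < N, the four edges at the ends of the two fundamental segments of the
     axes that begin at v- bound disjoint half-trees: a Schottky pair.
   - If L = N, then c = a b^-1 maps the point of the axis of a at distance s
     beyond v+ to the one at distance M - N - s, for s up to the length l_0 of
     the backward overlap of the axis of a with its image under b.  If
     2 l_0 >= M - N, a middle point is fixed (or an edge is flipped, which is
     excluded); otherwise c is hyperbolic and its axis starts at distance l_0
     from the one of b, and generators with edge-disjoint axes form a Schottky
     pair.
   - If L > N = M, then a b^-1 fixes exactly the last L - N edges of the overlap.

   Elliptic elements of a discrete group acting on a locally finite tree have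
   finite order, whereas free groups are torsion-free. *)

Import Order.TTheory GRing.Theory Num.Theory.
Local Open Scope classical_set_scope.

Lemma nat_minP (P : set nat) n :
  P n -> P (nat_min P) /\ forall i, P i -> nat_min P <= i.
Proof.
move=> Pn; rewrite /nat_min; apply: (@xgetPex nat 0%N
  [set n | P n /\ forall i, P i -> n <= i]).
have exP : exists i, `[< P i >] by exists n; apply/asboolP.
exists (ex_minn exP); case: ex_minnP => i /asboolP Pi mini.
by split=> // j Pj; apply: mini; apply/asboolP.
Qed.

(** * Non-backtracking paths, distances and half-trees in a tree *)

Section Paths.
Variable X : tree.
Implicit Types (x y z : X) (r s : nat -> X) (g h : aut X).

(** A path without backtracking, given as a function of which only the values at 0, ..., [n] count;
    shifting, reversing and gluing thus become index arithmetic. By acyclicity these are exactly the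
    geodesics of the tree. *)
Definition reduced r n : Prop :=
  (forall i, i < n -> adj (r i) (r i.+1)) /\
  (forall i, i.+2 <= n -> r i <> r i.+2).

Lemma reduced_leq r n k : reduced r n -> k <= n -> reduced r k.
Proof.
move=> [adj_r red_r] le_kn; split=> i lt_ik.
  by apply: adj_r; apply: leq_trans le_kn.
by apply: red_r; apply: leq_trans le_kn.
Qed.

Lemma reduced_shift r n k d :
  reduced r n -> k + d <= n -> reduced (fun i => r (k + i)) d.
Proof.
move=> [adj_r red_r] le_n; split=> i lt_i; rewrite !addnS.
  by apply: adj_r; lia.
by apply: red_r; lia.
Qed.

Lemma eq_reduced r s n : (forall i, i <= n -> r i = s i) ->
  reduced r n -> reduced s n.
Proof.
move=> rs [adj_r red_r]; split=> i lt_i.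
  by rewrite -!rs; [apply: adj_r | lia | lia].
by rewrite -!rs; [apply: red_r | lia | lia].
Qed.

Lemma reduced_rev r n : reduced r n -> reduced (fun i => r (n - i)) n.
Proof.
move=> [adj_r red_r]; split=> i lt_i.
  rewrite adj_sym; have := adj_r (n - i.+1).
  have -> : (n - i.+1).+1 = n - i by lia.
  by apply; lia.
move/esym; have := red_r (n - i.+2).
have -> : (n - i.+2).+2 = n - i by lia.
by apply; lia.
Qed.

Lemma reduced_aut g r n : reduced r n -> reduced (fun i => g (r i)) n.
Proof.
move=> [adj_r red_r]; split=> i lt_i; first by rewrite aut_adj; apply: adj_r.
by move/(can_inj (aut_funK g)); apply: red_r.
Qed.

(** Strong induction on the gap [d]: the vertices of a return after [d] steps are distinct up to the
    return, so they form a cycle. Gaps 1 and 2 are excluded by irreflexivity and by the absence of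
    backtracking, the longer ones by acyclicity. *)
Lemma reduced_inj r n : reduced r n -> forall i j, i < j <= n -> r i <> r j.
Proof.
move=> [adj_r red_r].
suff H : forall d i, 0 < d -> i + d <= n -> r i <> r (i + d).
  move=> i j ltij; have E : j = i + (j - i) by lia.
  by rewrite E; apply: H; lia.
move=> d; elim/ltn_ind: d => d IH i d_gt0 le_n rid.
have d_gt2 : 2 < d.
  case: d d_gt0 le_n rid {IH} => [|[|[|d]]] //= _ le_n rid.
    have lt_in : i < n by lia.
    by have := adj_r i lt_in; rewrite rid addn1 adj_irr.
  by case: (red_r i); [lia | rewrite rid addn2].
pose c := [seq r j | j <- iota i d].
suff: ucycle (@adj X) c by move/tree_acyclic; rewrite size_map size_iota; lia.
apply/andP; split.
  rewrite /c; case: d d_gt2 le_n rid {IH c d_gt0} => // d d_gt2 le_n rid.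
  rewrite /= -[rcons _ _]/(rcons [seq r j | j <- iota i.+1 d] (r i)).
  rewrite rid -map_rcons.
  have -> : rcons (iota i.+1 d) (i + d.+1) = iota i.+1 d.+1.
    by rewrite -(addn1 d) iotaD cats1 addn1 addSnnS.
  rewrite -rid; apply/(pathP (r i)) => j; rewrite size_map size_iota => ltj.
  rewrite (nth_map 0) ?size_iota // nth_iota //.
  have -> : nth (r i) (r i :: [seq r j | j <- iota i.+1 d.+1]) j = r (i + j).
    case: j ltj => [|j] ltj; first by rewrite addn0.
    rewrite -[LHS]/(nth (r i) [seq r j | j <- iota i.+1 d.+1] j).
    by rewrite (nth_map 0) ?size_iota ?nth_iota ?addSnnS //; lia.
  by rewrite addSn; apply: adj_r; lia.
rewrite /c map_inj_in_uniq ?iota_uniq // => j j'.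
rewrite !mem_iota => Hj Hj' rjj'; apply/eqP; case: (ltngtP j j') => // ltj.
  exfalso; apply: (IH (j' - j) _ j); rewrite ?subnKC //; lia.
exfalso; apply: (IH (j - j') _ j'); rewrite ?subnKC //; lia.
Qed.

(** The path that runs back along [r] from [r n] to [r 0] and then along [s]; it is meant for
    [r 0 = s 0]. *)
Definition gluepath r n s : nat -> X := fun i => if i <= n then r (n - i) else s (i - n).

Lemma gluepath0 r n s : gluepath r n s 0 = r n.
Proof. by rewrite /gluepath leq0n subn0. Qed.

Lemma gluepathR r n s k : r 0 = s 0 -> gluepath r n s (n + k) = s k.
Proof.
rewrite /gluepath => rs0; case: k => [|k]; first by rewrite addn0 leqnn subnn.
by rewrite ifN ?addKn //; lia.
Qed.

Lemma reduced_gluepath r n s k : reduced r n -> reduced s k -> r 0 = s 0 ->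
  (0 < n -> 0 < k -> r 1 <> s 1) -> reduced (gluepath r n s) (n + k).
Proof.
move=> red_r red_s rs0 rs1.
have [adj_r' red_r'] := reduced_rev red_r; have [adj_s red_s'] := red_s.
have geE i : n <= i -> gluepath r n s i = s (i - n).
  by move=> le_ni; rewrite -{1}(subnKC le_ni) gluepathR.
have leE i : i <= n -> gluepath r n s i = r (n - i) by rewrite /gluepath => ->.
split=> i lt_i.
  case: (ltnP i n) => [lt_in|le_ni]; first by rewrite !leE //; [exact: adj_r' | lia].
  by rewrite !geE ?subSn //; [apply: adj_s; lia | lia].
case: (ltngtP i.+1 n) => [lt_in|lt_ni|eq_in].
- by rewrite !leE; [exact: red_r' | lia..].
- by rewrite !geE ?(@subSn n i.+1) ?(@subSn n i); [apply: red_s'; lia | lia..].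
- rewrite leE ?geE; [|lia..].
  have -> : n - i = 1 by lia.
  have -> : i.+2 - n = 1 by lia.
  by apply: rs1; lia.
Qed.

Lemma branch_neq r n s k : reduced r n -> reduced s k -> r 0 = s 0 ->
  (0 < n -> 0 < k -> r 1 <> s 1) -> 0 < n + k -> r n <> s k.
Proof.
move=> red_r red_s rs0 rs1 nk; have red_g := reduced_gluepath red_r red_s rs0 rs1.
by rewrite -(gluepath0 r n s) -(gluepathR n k rs0); apply: (reduced_inj red_g); lia.
Qed.

(** If the first steps differed, gluing would give a closed non-backtracking path; so they agree,
    and induction applies to the tails. *)
Lemma reduced_unique r n s k : reduced r n -> reduced s k -> r 0 = s 0 ->
  r n = s k -> n = k /\ forall i, i <= n -> r i = s i.
Proof.
elim: n r s k => [|n IH] r s [|k] red_r red_s rs0 rsE.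
- by split=> // i; rewrite leqn0 => /eqP->.
- by case: (@branch_neq r 0 s k.+1).
- by case: (@branch_neq r n.+1 s 0).
have rs1 : r 1 = s 1.
  by apply: contrapT => rs1; case: (@branch_neq r n.+1 s k.+1).
have [||||->  E] := IH (fun i => r (1 + i)) (fun i => s (1 + i)) k.
- exact: reduced_shift red_r _.
- exact: reduced_shift red_s _.
- exact: rs1.
- exact: rsE.
by split=> // -[|i] // /E.
Qed.

Lemma distP x y : exists r, [/\ reduced r (dist x y), r 0 = x & r (dist x y) = y].
Proof.
have [p0 [p0P p0y]] := tree_connected x y.
have /nat_minP : [set size p | p in [set p | path (@adj X) x p /\ last x p = y]]
   (size p0) by exists p0.
rewrite -/(dist x y) => -[[p [pathp lastp] sz] mind].
exists (nth x (x :: p)); rewrite -sz; split=> //; last first.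
  by rewrite -lastp (last_nth x).
split=> [i lt_i|i lt_i E]; first by move/(pathP x): pathp; apply.
(* A shortest path cannot backtrack: cutting out the two steps between equal vertices would shorten
   it. *)
have := mind (size (take i p ++ drop i.+2 p)); move: (pathp) (lastp).
rewrite -[p in path _ _ p](cat_take_drop i) -[p in last _ p](cat_take_drop i).
rewrite cat_path last_cat => /andP[path1 path2] last2.
have Eq : nth x p i.+1 = last x (take i p).
  rewrite -[LHS]/(nth x (x :: p) i.+2) -E (last_nth x) size_take.
  rewrite ifT; last lia.
  by case: i {lt_i E path1 path2 last2} => //= i; rewrite nth_take.
move: path2 last2; rewrite (drop_nth x) ?(@drop_nth _ x i.+1) //; last lia.
rewrite /= -Eq => /and3P[_ _ path2] last2 /(_ _)/wrap[|].
  exists (take i p ++ drop i.+2 p) => //; split.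
    by rewrite cat_path path1 -Eq.
  by rewrite last_cat -Eq.
by rewrite -sz size_cat size_take size_drop /=; case: ifP; lia.
Qed.

Lemma dist_reduced r n : reduced r n -> dist (r 0) (r n) = n.
Proof.
move=> red_r; have [s [red_s s0 sn]] := distP (r 0) (r n).
by have [] := reduced_unique red_s red_r s0 sn.
Qed.

Lemma dist_branch r n s k : reduced r n -> reduced s k -> r 0 = s 0 ->
  (0 < n -> 0 < k -> r 1 <> s 1) -> dist (r n) (s k) = n + k.
Proof.
move=> red_r red_s rs0 rs1; have /dist_reduced := reduced_gluepath red_r red_s rs0 rs1.
by rewrite gluepath0 gluepathR.
Qed.

Lemma distC x y : dist x y = dist y x.
Proof.
have [r [red_r r0 rn]] := distP x y.
by have := dist_reduced (reduced_rev red_r); rewrite subn0 subnn r0 rn => ->.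
Qed.

Lemma dist_aut g x y : dist (g x) (g y) = dist x y.
Proof.
have [r [red_r r0 rn]] := distP x y.
by have := dist_reduced (reduced_aut g red_r); rewrite r0 rn.
Qed.

Lemma distxx x : dist x x = 0.
Proof. by apply: (@dist_reduced (fun=> x) 0). Qed.

Lemma dist_eq0 x y : dist x y = 0 -> x = y.
Proof. by have [r [_ <- E]] := distP x y => d0; rewrite -E d0. Qed.

Lemma dist_adj x y : adj x y -> dist x y = 1.
Proof.
move=> xy; apply: (@dist_reduced (fun i => if i is 0 then x else y) 1).
by split=> -[|i].
Qed.

Lemma dist_path x p : path (@adj X) x p -> dist x (last x p) <= size p.
Proof.
move=> path_p; have := @nat_minP
  [set size q | q in [set q | path (@adj X) x q /\ last x q = last x p]] (size p).
by case=> [|_]; [exists p | apply; exists p].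
Qed.

Lemma reduced_path r n : reduced r n ->
  path (@adj X) (r 0) [seq r i.+1 | i <- iota 0 n] /\
  last (r 0) [seq r i.+1 | i <- iota 0 n] = r n.
Proof.
move=> [adj_r _]; elim: n adj_r => [|n IH] adj_r //.
have [i|path_r last_r] := IH; first by move=> lt_in; apply: adj_r; lia.
rewrite -addn1 iotaD map_cat cat_path last_cat path_r last_r /= andbT add0n.
by rewrite addn1; split=> //; apply: adj_r; lia.
Qed.

Lemma dist_triangle x y z : dist x z <= dist x y + dist y z.
Proof.
have [r [red_r r0 rn]] := distP x y; have [s [red_s s0 sn]] := distP y z.
have [path_r last_r] := reduced_path red_r.
have [path_s last_s] := reduced_path red_s.
rewrite r0 rn in path_r last_r; rewrite s0 sn in path_s last_s.
have := @dist_path x ([seq r i.+1 | i <- iota 0 (dist x y)] ++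
  [seq s i.+1 | i <- iota 0 (dist y z)]).
rewrite cat_path last_cat last_r path_r path_s last_s.
by rewrite size_cat !size_map !size_iota; apply.
Qed.

(** For adjacent [x] and [y], the side of [y] after removal of the edge. The metric form makes
    complements and images under automorphisms immediate; [component_halftree] relates it to
    connected components. *)
Definition halftree x y : set X := [set z | dist z x = (dist z y).+1].

Lemma halftree_dichotomy x y z : adj x y -> halftree x y z \/ halftree y x z.
Proof.
move=> xy; rewrite /halftree /= !(distC z).
have [r [red_r r0 rn]] := distP x z.
pose s i := if i is 0 then x else y.
have red_s : reduced s 1 by split=> -[].
have [[d_gt0 r1]|Ny] := pselect (0 < dist x z /\ r 1 = y).
  left; have le_d : 1 + (dist x z).-1 <= dist x z by lia.
  have := dist_reduced (reduced_shift red_r le_d).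
  by rewrite addn0 r1 add1n prednK // rn => ->; rewrite prednK.
right; have := @dist_branch s 1 r (dist x z) red_s red_r.
rewrite add1n rn => -> //.
by move=> _ d_gt0 r1; apply: Ny.
Qed.

Lemma setC_halftree x y : adj x y -> ~` halftree x y = halftree y x.
Proof.
move=> xy; apply/seteqP; split=> z /=.
  by case: (halftree_dichotomy z xy).
by rewrite /halftree /= => ->; lia.
Qed.

Lemma halftree_aut g x y : g @` halftree x y = halftree (g x) (g y).
Proof.
apply/seteqP; split=> [_ [z zP <-]|z] /=; first by rewrite /halftree /= !dist_aut.
by rewrite /halftree /= -{1 2}(aut_invK g z) !dist_aut => zP; exists (aut_inv g z); rewrite ?aut_invK.
Qed.

(** The geodesic from [r n.+1] to [z] does not start by going back to [r n], so it prolongs [r] to a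
    geodesic. *)
Lemma halftree_reduced r n z : reduced r n.+1 -> halftree (r n) (r n.+1) z ->
  dist z (r 0) = dist z (r n.+1) + n.+1.
Proof.
move=> red_r; rewrite /halftree /= !(distC z) => zP.
have [s [red_s s0 sn]] := distP (r n.+1) z.
have := @dist_branch (fun i => r (n.+1 - i)) n.+1 s (dist (r n.+1) z).
rewrite subnn subn0 sn addnC; apply=> //; first exact: reduced_rev.
move=> _ d_gt0; rewrite subn1 /= => rs1.
have le_d : 1 + (dist (r n.+1) z).-1 <= dist (r n.+1) z by lia.
have := dist_reduced (reduced_shift red_s le_d).
rewrite addn0 -rs1 add1n prednK // sn; lia.
Qed.

(** A point [z] beyond the end of [r] is reached from [s k] and from [s k.+1] through the common
    origin, so it is nearer to [s k]; beyond the end of [s] it would be nearer to [s k.+1]. *)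
Lemma halftree_disjoint r n s k : reduced r n.+1 -> reduced s k.+1 -> r 0 = s 0 ->
  r 1 <> s 1 -> halftree (r n) (r n.+1) `&` halftree (s k) (s k.+1) = set0.
Proof.
move=> red_r red_s rs0 rs1; rewrite -subset0 => z [zr zs].
have red_g : reduced (gluepath s k.+1 r) (k.+1 + n.+1).
  by apply: reduced_gluepath => // _ _ /esym.
have red_g' : reduced (gluepath s k r) (k + n.+1).
  apply: reduced_gluepath => //; first exact: reduced_leq red_s _.
  by move=> _ _ /esym.
have gE a i : gluepath s a r (a + i) = r i by rewrite gluepathR.
move: (red_g) (red_g'); rewrite !addnS => /halftree_reduced H /halftree_reduced H'.
have := H z; have := H' z.
rewrite -!addnS !gE !gluepath0 => /(_ zr) E /(_ zr) E'.
by move: zs; rewrite /halftree /=; lia.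
Qed.

Lemma halftree_adj x y u v : adj x y -> adj u v -> halftree x y u -> halftree y x v ->
  u = y /\ v = x.
Proof.
move=> xy uv; rewrite /halftree /= !(distC u) !(distC v) => ux vx.
have [s [red_s s0 sn]] := distP y u.
pose e1 i := if i is 0 then y else x.
pose e2 i := if i is 0 then u else v.
have red_e1 : reduced e1 1 by split=> -[] //=; rewrite adj_sym.
have red_e2 : reduced e2 1 by split=> -[].
pose r := gluepath e1 1 s.
have red_r : reduced r (dist x u).
  rewrite ux -add1n; apply: reduced_gluepath => // _ d_gt0 /= s1.
  have le_d : 1 + (dist y u).-1 <= dist y u by lia.
  have := dist_reduced (reduced_shift red_s le_d).
  by rewrite addn0 -s1 add1n prednK // sn; lia.
have ru : r (dist x u) = u by rewrite ux -add1n /r gluepathR.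
have rv : r (dist y u) = v.
  apply: contrapT => rv; have := dist_triangle y u v; rewrite (dist_adj uv).
  have := @dist_branch (fun i => r (dist x u - i)) (dist x u) e2 1.
  rewrite subnn subn0 ru /= => H.
  by rewrite vx H //; [lia | exact: reduced_rev | rewrite ux subn1].
have xv := dist_reduced (reduced_leq red_r (_ : dist y u <= dist x u)).
move: xv; rewrite ux leqnSn rv -[r 0]/x => /(_ isT) xv.
have [d0|d_gt0] := posnP (dist y u).
  by split; [exact/esym/dist_eq0 | apply/esym/dist_eq0; rewrite xv].
have le_d : 1 + (dist y u).-1 <= dist x u by lia.
have := dist_reduced (reduced_shift red_r le_d).
rewrite -[r (1 + 0)]/y.
have -> : 1 + (dist y u).-1 = dist y u by lia.
rewrite rv; lia.
Qed.

Lemma set2_eq (T : Type) (a b c d : T) : [set a; b] = [set c; d] ->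
  (a = c /\ b = d) \/ (a = d /\ b = c).
Proof.
move=> E.
have /= Ha : [set c; d] a by rewrite -E; left.
have /= Hb : [set c; d] b by rewrite -E; right.
have /= Hc : [set a; b] c by rewrite E; left.
have /= Hd : [set a; b] d by rewrite E; right.
by case: Ha => Ha; case: Hb => Hb; case: Hc; case: Hd; intuition congruence.
Qed.

(** Geodesics issued from [y] to points of the half-tree stay in it, hence avoid the edge;
    conversely, by [halftree_adj], a path can leave the half-tree only through the edge. *)
Lemma component_halftree x y : adj x y -> component_minus_edge [set x; y] (halftree x y).
Proof.
move=> xy; exists y; apply/seteqP; split=> z /=.
  move=> zP; have [r [red_r r0 rn]] := distP y z.
  have r_half i : i <= dist y z -> halftree x y (r i).
    move=> le_i; case: (halftree_dichotomy (r i) xy) => // riP; exfalso.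
    have [s [red_s s0 sn]] := distP (r i) z.
    have := dist_triangle z (r i) x; move: riP zP; rewrite /halftree /=.
    rewrite -!r0 (distC (r i)) (dist_reduced (reduced_leq red_r le_i)).
    rewrite -{4}rn (distC (r _) (r i)) r0 (distC z y).
    have := dist_reduced (reduced_shift red_r
      (_ : i + (dist y z - i) <= dist y z)).
    rewrite addn0 subnKC // => /(_ (leqnn _)) ->; lia.
  have [path_r last_r] := reduced_path red_r.
  rewrite r0 rn in path_r last_r.
  exists [seq r i.+1 | i <- iota 0 (dist y z)]; split=> //.
  apply/(pathP y) => i; rewrite size_map size_iota => lt_i.
  move/(pathP y): path_r => /(_ i); rewrite size_map size_iota => /(_ lt_i) ->.
  have : halftree x y (nth y (y :: [seq r i.+1 | i <- iota 0 (dist y z)]) i).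
    case: i lt_i => [|i] lt_i /=; first by rewrite -{2}r0; apply: r_half.
    by rewrite (nth_map 0) ?size_iota ?nth_iota; [apply: r_half|..]; lia.
  have : halftree x y (nth y [seq r i.+1 | i <- iota 0 (dist y z)] i).
    by rewrite (nth_map 0) ?size_iota ?nth_iota; [apply: r_half|..]; lia.
  move=> h1 h2; apply/eqP => E0; have E := set2_eq E0.
  have nx : ~ halftree x y x by rewrite /halftree /= distxx.
  by case: E => -[E1 E2]; [move: h2; rewrite E1 | move: h1; rewrite E2].
move=> [p [path_p <-]].
have : halftree x y y by rewrite /halftree /= distxx distC; exact: dist_adj.
move: path_p; move: {2 4 6}y => u; elim: p u => //= v p IH u.
move=> /andP[/andP[uv /eqP Euv] path_p] uP.
apply: IH => //; case: (halftree_dichotomy v xy) => // vP.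
by have [Eu Ev] := halftree_adj xy uv uP vP; case: Euv; rewrite Eu Ev setUC.
Qed.

End Paths.

Local Open Scope ring_scope.

(** * Bi-infinite geodesics, translations along them, and axes *)

Section Lines.
Variable X : tree.
Implicit Types (x y z : X) (f : int -> X) (g h : aut X).

Definition line f : Prop :=
  forall t : int, adj (f t) (f (t + 1)) /\ f t <> f (t + 2).

(** A signed offset, by which both rays of a line from a given point are treated at once as paths
    indexed by naturals. *)
Definition along (b : bool) (i : nat) : int := if b then i%:Z else - i%:Z.
Arguments along b i%_nat_scope.

Lemma reduced_line f s b n : line f -> reduced (fun i => f (s + along b i)) n.
Proof.
move=> linef; split=> i _; case: b; rewrite /along.
- by have [+ _] := linef (s + i%:Z); congr adj; congr f; lia.
- by rewrite adj_sym; have [+ _] := linef (s - i.+1%:Z); congr adj; congr f; lia.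
- by have [_] := linef (s + i%:Z); congr (_ <> _); congr f; lia.
- by apply: nesym; have [_] := linef (s - i.+2%:Z); congr (_ <> _); congr f; lia.
Qed.

Lemma dist_line f s t : line f -> dist (f s) (f t) = `|s - t|%N.
Proof.
move=> linef; have [le_st|lt_ts] := lerP s t.
  have := dist_reduced (reduced_line s true `|s - t|%N linef).
  by rewrite /along addr0; have -> : s + `|s - t|%N%:Z = t by lia.
have := dist_reduced (reduced_line s false `|s - t|%N linef).
by rewrite /along oppr0 addr0; have -> : s - `|s - t|%N%:Z = t by lia.
Qed.

Lemma line_inj f s t : line f -> f s = f t -> s = t.
Proof. by move=> linef E; have := dist_line s t linef; rewrite E distxx; lia. Qed.

Lemma line_shift f s : line f -> line (fun t => f (s + t)).
Proof. by move=> linef t; have := linef (s + t); rewrite -!addrA. Qed.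

Lemma line_aut g f : line f -> line (fun t => g (f t)).
Proof.
move=> linef t; have [adj_t red_t] := linef t; rewrite aut_adj; split=> //.
by move/(can_inj (aut_funK g)).
Qed.

Lemma dist_lines f f' s t b c i j : line f -> line f' -> f s = f' t ->
  f (s + along b 1) <> f' (t + along c 1) ->
  dist (f (s + along b i)) (f' (t + along c j)) = (i + j)%N.
Proof.
move=> linef linef' E N.
apply: (@dist_branch X (fun i => f (s + along b i)) i
  (fun j => f' (t + along c j)) j) => //; try exact: reduced_line.
by rewrite /along; case: b c {N} => -[]; rewrite ?oppr0 !addr0.
Qed.

Lemma lines_agree f f' s t b c i j : line f -> line f' -> f s = f' t ->
  f (s + along b i) = f' (t + along c j) ->
  i = j /\ forall k, (k <= i)%N -> f (s + along b k) = f' (t + along c k).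
Proof.
move=> linef linef' E Eij.
apply: (reduced_unique (reduced_line s b i linef) (reduced_line t c j linef')) => //.
by rewrite /along; case: b c {Eij} => -[]; rewrite ?oppr0 !addr0.
Qed.

Lemma half_lines_disjoint f f' s t b c i j : line f -> line f' -> f s = f' t ->
  f (s + along b 1) <> f' (t + along c 1) ->
  halftree (f (s + along b i)) (f (s + along b i.+1)) `&`
  halftree (f' (t + along c j)) (f' (t + along c j.+1)) = set0.
Proof.
move=> linef linef' E N.
apply: (@halftree_disjoint X (fun i => f (s + along b i)) i
  (fun j => f' (t + along c j)) j) => //; try exact: reduced_line.
by rewrite /along; case: b c {N} => -[]; rewrite ?oppr0 !addr0.
Qed.

Lemma line_neighbor f s x : line f -> adj (f s) x -> range f x ->
  x = f (s + 1) \/ x = f (s - 1).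
Proof.
move=> linef /dist_adj + [t _ Ex]; rewrite -Ex (dist_line _ _ linef) => st.
have [->|->] : t = s + 1 \/ t = s - 1; [lia | by left | by right].
Qed.

Definition translates g f (m : nat) : Prop :=
  [/\ line f, (0 < m)%N & forall t, g (f t) = f (t + m%:Z)].

Lemma translates_inv g f m t : translates g f m -> aut_inv g (f t) = f (t - m%:Z).
Proof. by move=> [_ _ gf]; apply: (can_inj (aut_funK g)); rewrite aut_invK gf subrK. Qed.

Lemma translates_shift g f m s :
  translates g f m -> translates g (fun t => f (s + t)) m.
Proof.
move=> [linef m_gt0 gf]; split=> // [|t]; first exact: line_shift.
by rewrite gf addrA.
Qed.

Lemma translates_exp g f m n : translates g f m ->
  forall t, (g ^+ n)%g (f t) = f (t + (n * m)%N%:Z).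
Proof.
move=> [_ _ gf]; elim: n => [|n IH] t; first by rewrite mul0n addr0.
by rewrite expgS /= IH gf; congr f; lia.
Qed.

(* d is the distance of x to the line. *)
Lemma dist_translates g f m x : translates g f m ->
  exists d, dist x (g x) = (m + d.*2)%N /\ (d = 0%N -> range f x).
Proof.
move=> [linef m_gt0 gf].
have [t mint] : exists t, forall s, (dist x (f t) <= dist x (f s))%N.
  have [[t _ Et] mint] := @nat_minP (range (fun t => dist x (f t)))
    (dist x (f 0)) (imageP _ I).
  by exists t => s; rewrite Et; apply: mint; apply: imageP.
have [r [red_r r0 rd]] := distP (f t) x; exists (dist (f t) x).
split; last by move/dist_eq0 => <-; exists t.
have r1 : (0 < dist (f t) x)%N -> ~ range f (r 1%N).
  move=> d_gt0 [s _ Es]; have := mint s; rewrite Es (distC x) (distC x).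
  have le_d : (1 + (dist (f t) x).-1 <= dist (f t) x)%N by lia.
  have := dist_reduced (reduced_shift red_r le_d).
  by rewrite addn0 add1n prednK // rd; lia.
(* The geodesic from [x] to [g x] goes down to the nearest point [f t], along the line to [g (f t)],
   and up again along the image of [r]. Neither turn backtracks, because [r] leaves the line at its
   first step. *)
pose c := gluepath r (dist (f t) x) (fun i => f (t + along true i)).
have red_c : reduced c (dist (f t) x + m).
  apply: reduced_gluepath => //; first exact: reduced_line.
    by rewrite r0 addr0.
  by move=> d_gt0 _ E; apply: (r1 d_gt0); exists (t + 1).
have := @dist_branch X (fun i => c (dist (f t) x + m - i)%N) (dist (f t) x + m)%N
   (fun i => g (r i)) (dist (f t) x).
rewrite subnn subn0 /c gluepath0 gluepathR ?rd; last by rewrite r0 addr0.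
move=> -> //.
- lia.
- exact: reduced_rev.
- exact: reduced_aut.
- by rewrite r0 gf.
move=> _ d_gt0; have -> : (dist (f t) x + m - 1 = dist (f t) x + m.-1)%N by lia.
rewrite gluepathR ?r0 ?addr0 // => E; apply: (r1 d_gt0).
exists (t + along true m.-1 - m%:Z) => //; apply: (can_inj (aut_funK g)).
by rewrite gf subrK -E.
Qed.

(** The displacement [m + d.*2] of [dist_translates] is minimal exactly on the line. It is never 0,
    so nothing is fixed; an inversion is impossible since its square would have a fixed point,
    whereas [g ^+ 2] translates the same line. *)
Lemma translates_axis g f m : translates g f m ->
  [/\ hyperbolic g, translation_length g = m & axis g = range f].
Proof.
move=> gfm; have [linef m_gt0 gf] := gfm.
have distf t : dist (f t) (g (f t)) = m by rewrite gf (dist_line _ _ linef); lia.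
have mE : translation_length g = m.
  have [[x _ Ex] minm] := @nat_minP [set dist x (g x) | x in [set: X]]
    (dist (f 0) (g (f 0))) (imageP _ I).
  have [d [Ed _]] := dist_translates x gfm.
  have := minm _ (imageP _ (I : [set: X] (f 0))); rewrite -Ex distf.
  rewrite /translation_length -Ex; lia.
split=> //; last first.
  apply/seteqP; split=> [x|_ [t _ <-]]; rewrite /axis /= mE //.
  by have [d [-> /[swap] Ed]] := dist_translates x gfm; apply; lia.
split=> [[x Ex]|[x [y [_ gx gy]]]].
  by have [d [+ _]] := dist_translates x gfm; rewrite Ex distxx; lia.
have gfm2 : translates (g ^+ 2)%g f (2 * m).
  split=> // [|t]; first lia.
  exact: translates_exp gfm _.
have [d [+ _]] := dist_translates x gfm2.
by rewrite /= gx gy distxx; lia.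
Qed.

Definition zexp g (k : int) : aut X :=
  match k with Posz n => (g ^+ n)%g | Negz n => (g ^- n.+1)%g end.

Lemma zexpS g k : zexp g (k + 1) = (g * zexp g k)%g.
Proof.
case: k => [n|[|n]].
- have -> : Posz n + 1 = Posz n.+1 by lia.
  by rewrite /= expgS.
- by rewrite /= mulgV.
- have -> : Negz n.+1 + 1 = Negz n by lia.
  by rewrite /= [in RHS]expgSr invgM mulVKg.
Qed.

Lemma zexpSr g k : zexp g (k + 1) = (zexp g k * g)%g.
Proof.
case: k => [n|[|n]].
- have -> : Posz n + 1 = Posz n.+1 by lia.
  by rewrite /= expgSr.
- by rewrite /= mulVg.
- have -> : Negz n.+1 + 1 = Negz n by lia.
  by rewrite /= [in RHS]expgS invgM mulgVK.
Qed.

(** The images of the segment [r] under the powers of [g] fit together into a line; the last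
    hypothesis excludes backtracking at the junctions. *)
Lemma translates_extend g (r : nat -> X) m : (0 < m)%N -> reduced r m ->
  g (r 0%N) = r m -> g (r 1%N) <> r m.-1 ->
  exists f, translates g f m /\ forall i, (i <= m)%N -> f i%:Z = r i.
Proof.
move=> m_gt0 [adj_r red_r] gr0 gr1.
pose f t := zexp g (t %/ m%:Z)%Z (r `|(t %% m%:Z)%Z|%N).
have fE k i : (i <= m)%N -> f (k * m%:Z + i%:Z) = zexp g k (r i).
  rewrite leq_eqVlt => /orP[/eqP->|lt_im]; last first.
    by rewrite /f divzMDl ?modzMDl ?divz_small ?modz_small ?addr0 //; lia.
  rewrite -{2}(mul1r m%:Z) -mulrDl -[_ * _]addr0 /f divzMDl ?modzMDl; last lia.
  by rewrite div0z mod0z addr0 zexpSr /= gr0.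
exists f; split=> [|i le_im]; last by rewrite -[i%:Z]add0r -(mul0r m%:Z) fE.
split=> // t.
  have m_neq0 : m%:Z != 0 by lia.
  rewrite (divz_eq t m%:Z); set k := (t %/ _)%Z.
  have mod_ge0 := modz_ge0 t m_neq0; have mod_lt := ltz_mod t m_neq0.
  have [i lt_im ->] : exists2 i, (i < m)%N & (t %% m%:Z)%Z = i%:Z.
    by exists `|(t %% m%:Z)%Z|%N; lia.
  rewrite fE 1?ltnW //.
  have -> : k * m + i%:Z + 1 = k * m + i.+1%:Z by lia.
  rewrite fE // aut_adj; split; first exact: adj_r.
  have -> : k * m + i%:Z + 2 = k * m + i.+2%:Z by lia.
  have [le_im|lt_mi] := leqP i.+2 m.
    by rewrite fE // => /(can_inj (aut_funK _)); apply: red_r.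
  (* Here [i] is [m.-1]: the two steps cross the junction of two consecutive images of [r]. *)
  have -> : k * m + i.+2%:Z = (k + 1) * m%:Z + 1%N%:Z by nia.
  rewrite fE // zexpSr => /(can_inj (aut_funK _)) E; apply: gr1.
  by rewrite -E; congr r; lia.
have -> : t + m%:Z = 1 * m%:Z + t by lia.
by rewrite /f divzMDl ?modzMDl 1?[1 + _]addrC ?zexpS; last lia.
Qed.

(** A geodesic from a vertex of minimal displacement to its image is a fundamental segment.
    Backtracking at the junction would displace [r 1] by two less, or, if the displacement is 1,
    make [g] flip an edge. *)
Lemma hyperbolic_translates g : hyperbolic g ->
  exists f, translates g f (translation_length g).
Proof.
move=> [nell ninv].
have [x0] := tree_nonempty X.
have [[x _ Ex] minm] := @nat_minP [set dist x (g x) | x in [set: X]]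
  (dist x0 (g x0)) (imageP _ I).
rewrite -/(translation_length g) in Ex minm.
have [r [red_r r0 rd]] := distP x (g x); rewrite Ex in red_r rd.
have d_gt0 : (0 < translation_length g)%N.
  by rewrite lt0n -Ex; apply/eqP => /dist_eq0 E; apply: nell; exists x.
suff [f [gf _]] : exists f, translates g f (translation_length g) /\
    forall i, (i <= translation_length g)%N -> f i%:Z = r i by exists f.
apply: translates_extend => //; first by rewrite r0 rd.
move=> gr1; have [adj_r _] := red_r.
case: (ltngtP (translation_length g) 1) => [|d_gt1|d1]; first lia.
  have := minm _ (imageP _ (I : [set: X] (r 1%N))); rewrite gr1.
  have le_d : (1 + (translation_length g).-2 <= translation_length g)%N by lia.
  have := dist_reduced (reduced_shift red_r le_d).
  have -> : (1 + (translation_length g).-2 = (translation_length g).-1)%N by lia.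
  by rewrite addn0 => ->; lia.
apply: ninv; exists x, (g x); split=> //.
  by have := adj_r 0%N; rewrite d1 r0 -rd d1; apply.
by move: gr1; rewrite d1 /= r0 -[1%N]d1 rd.
Qed.

End Lines.

(** * Generated subgroups, words, and torsion in free groups *)

Section Generated.
Variable G : groupType.
Implicit Types (S H : set G) (x y : G) (u v : G * bool) (w : seq (G * bool)).
Local Open Scope group_scope.

Lemma sub_generated S : S `<=` generated S.
Proof. by move=> x Sx H [_]; apply. Qed.

Lemma generated1 S : generated S 1.
Proof. by move=> H [[+ _] _]; rewrite in_setE. Qed.

Lemma generated_div S x y : generated S x -> generated S y -> generated S (x / y).
Proof.
move=> Sx Sy H HS; have := HS => -[[_ closedH] _].
by have := closedH x y; rewrite !in_setE; apply; [apply: Sx | apply: Sy].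
Qed.

Lemma generatedV S x : generated S x -> generated S x^-1.
Proof. by rewrite -(mul1g x^-1); apply: generated_div; apply: generated1. Qed.

Lemma generatedM S x y : generated S x -> generated S y -> generated S (x * y).
Proof. by move=> Sx /generatedV; rewrite -{2}(invgK y); apply: generated_div. Qed.

Lemma generatedX S x n : generated S x -> generated S (x ^+ n).
Proof.
move=> Sx; elim: n => [|n IH]; first exact: generated1.
by rewrite expgS; apply: generatedM.
Qed.

Lemma generated_min S H : H 1 -> (forall x y, H x -> H y -> H (x / y)) ->
  S `<=` H -> generated S `<=` H.
Proof.
move=> H1 HD SH x; apply; split=> //; split; first by rewrite in_setE.
by move=> u v; rewrite !in_setE; apply: HD.
Qed.

Lemma generated_eq S S' : S `<=` generated S' -> S' `<=` generated S ->
  generated S = generated S'.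
Proof.
by move=> SS' S'S; apply/seteqP; split; apply: generated_min => //;
  solve [exact: generated1 | exact: generated_div].
Qed.

(** The Nielsen move behind each subtraction of the Euclidean algorithm. *)
Lemma generated2_div x y : generated [set x; y] = generated [set x * y^-1; y].
Proof.
apply: generated_eq => _ [|] ->.
- rewrite -[x](mulgVK y); apply: generatedM; apply: sub_generated; last by right.
  by left; rewrite mulgVK.
- by apply: sub_generated; right.
- by apply: generated_div; apply: sub_generated; [left | right].
- by apply: sub_generated; right.
Qed.

Definition letter_eval (u : G * bool) : G := if u.2 then u.1 else u.1^-1.

Definition letter_rel (u v : G * bool) : bool := ~~ ((u.1 == v.1) && (u.2 != v.2)).

Lemma letter_cancel u v : ~~ letter_rel u v -> letter_eval u * letter_eval v = 1.
Proof.
case: u v => [u b] [v c]; rewrite negbK => /andP[/eqP /= -> bc].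
by case: b c bc => -[] // _; rewrite /letter_eval /= ?mulgV ?mulVg.
Qed.

Lemma not_reduced_word w : ~~ reduced_word w ->
  exists w1 u v w2, w = w1 ++ [:: u, v & w2] /\ ~~ letter_rel u v.
Proof.
elim: w => // u [|v w] IH //; rewrite /reduced_word /= -/(letter_rel u v).
have [uv|Nuv _] := boolP (letter_rel u v); last by exists [::], u, v, w.
by case/IH => w1 [a [b [w2 [-> ab]]]]; exists (u :: w1), a, b, w2.
Qed.

Lemma reduced_word_pow u w n : reduced_word (u :: w) -> letter_rel (last u w) u ->
  reduced_word (flatten (nseq n (u :: w))).
Proof.
rewrite -![reduced_word _]/(sorted letter_rel _) => red_w wu; case: n => // n.
rewrite /=; elim: n => [|n IH] /=; first by rewrite cats0.
rewrite -cat_rcons cat_path last_rcons IH andbT rcons_path.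
by rewrite wu andbT.
Qed.

Lemma word_eval_cat (w1 w2 : seq (G * bool)) : word_eval (w1 ++ w2) = word_eval w1 * word_eval w2.
Proof. by rewrite /word_eval big_cat. Qed.

Lemma word_eval_cons u w : word_eval (u :: w) = letter_eval u * word_eval w.
Proof. by rewrite /word_eval big_cons. Qed.

Lemma word_eval_pow w n : word_eval (flatten (nseq n w)) = word_eval w ^+ n.
Proof.
elim: n => [|n IH]; first by rewrite /word_eval big_nil.
by rewrite /= word_eval_cat IH expgS.
Qed.

Definition word_inv (w : seq (G * bool)) := rev [seq (u.1, ~~ u.2) | u <- w].

Lemma word_eval_inv w : word_eval (word_inv w) = (word_eval w)^-1.
Proof.
elim: w => [|[u b] w IH]; first by rewrite /word_eval !big_nil invg1.
rewrite /word_inv /= rev_cons -cats1 word_eval_cat IH !word_eval_cons invgM.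
congr (_ * _); rewrite /word_eval big_nil mulg1 /letter_eval /=.
by case: b => //=; rewrite invgK.
Qed.

Lemma generated_word S x : generated S x ->
  exists2 w, (forall u, u \in w -> S u.1) & x = word_eval w.
Proof.
pose H := [set y | exists2 w, (forall u, u \in w -> S u.1) & y = word_eval w].
apply: (@generated_min S H).
- by exists [::] => //; rewrite /word_eval big_nil.
- move=> _ _ [w Sw ->] [w' Sw' ->]; exists (w ++ word_inv w').
    move=> u; rewrite mem_cat => /orP[/Sw//|]; rewrite mem_rev.
    by case/mapP => v /Sw' Sv ->.
  by rewrite word_eval_cat word_eval_inv.
- move=> y Sy; exists [:: (y, true)]; first by move=> u; rewrite inE => /eqP->.
  by rewrite word_eval_cons /word_eval big_nil mulg1.
Qed.

(* A shortest word representing a conjugate of x is cyclically reduced, so its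
   powers are reduced. *)
Lemma free_torsion_free H x n : is_free H -> H x -> (0 < n)%N -> x ^+ n = 1 -> x = 1.
Proof.
move=> [S [-> freeS]] /generated_word[w0 Sw0 xE] n_gt0 xn.
pose conj w := (forall u, u \in w -> S u.1) /\ exists c, x = c * word_eval w * c^-1.
have conj_w0 : conj w0 by split=> //; exists 1; rewrite invg1 mulg1 mul1g.
have [[w [Sw [c xc]] szw] minw] := @nat_minP [set size w | w in conj] (size w0)
  (imageP _ conj_w0).
rewrite -szw in minw; have {}minw w' : conj w' -> (size w <= size w')%N.
  by move=> cw'; apply: minw; exists w'.
case: w => [|u w] in Sw xc szw minw *.
  by rewrite xc /word_eval big_nil mulg1 mulgV.
exfalso; have red_w : reduced_word (u :: w).
  apply: contrapT => /negP/not_reduced_word[w1 [a [b [w2 [wE ab]]]]].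
  suff /minw : conj (w1 ++ w2) by rewrite wE !size_cat /=; lia.
  split=> [v|]; first by rewrite mem_cat => vw; apply: Sw; rewrite wE mem_cat !inE;
    case/orP: vw => ->; rewrite ?orbT.
  exists c; rewrite xc wE !word_eval_cat !word_eval_cons (mulgA (letter_eval a)).
  by rewrite (letter_cancel ab) mul1g.
have wu : letter_rel (last u w) u.
  apply: contrapT => /negP; case/lastP: w => [|w v] in Sw xc szw minw red_w *.
    by rewrite /= /letter_rel eqxx /= negbK; case: u.2.
  rewrite last_rcons => /letter_cancel vu.
  suff /minw : conj w by rewrite /= size_rcons; lia.
  split=> [z zw|]; first by apply: Sw; rewrite inE mem_rcons inE zw !orbT.
  (* The first and the last letter are inverse to each other, so both are absorbed into the
     conjugating element. *)
  exists (c * letter_eval u); rewrite xc word_eval_cons -cats1 word_eval_cat.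
  have -> : word_eval [:: v] = (letter_eval u)^-1.
    rewrite word_eval_cons {1}/word_eval big_nil mulg1.
    by rewrite -[LHS](mulgK (letter_eval u)) vu mul1g.
  by rewrite invgM !mulgA.
apply: (freeS (flatten (nseq n (u :: w)))).
- by case: n n_gt0 {xn}.
- by move=> v /flattenP[s /nseqP[-> _]] /Sw.
- exact: reduced_word_pow.
rewrite word_eval_pow.
have -> : word_eval (u :: w) = c^-1 * x * c by rewrite xc !mulgA mulVg mul1g mulgVK.
have -> : (c^-1 * x * c) ^+ n = c^-1 * x ^+ n * c.
  elim: n {n_gt0 xn} => [|k IH]; first by rewrite !expg0 mulg1 mulVg.
  by rewrite !expgS IH !mulgA mulgK.
by rewrite xn mulg1 mulVg.
Qed.

End Generated.

(** * Finite order of the elliptic elements of a discrete group *)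

Lemma pigeonhole (T : choiceType) (A : set T) (F : nat -> T) :
  finite_set A -> (forall i, A (F i)) -> exists i j, (i < j)%N /\ F i = F j.
Proof.
move=> /finite_seqP[s sA] AF.
have : ~~ uniq [seq F i | i <- iota 0 (size s).+1].
  apply/negP => /uniq_leq_size H.
  have : {subset [seq F i | i <- iota 0 (size s).+1] <= s}.
    by move=> _ /mapP[i _ ->]; have := AF i; rewrite sA.
  by move/(H s); rewrite size_map size_iota ltnn.
case/(uniqPn (F 0%N)) => i [j []]; rewrite size_map size_iota => ltij ltj.
rewrite !(nth_map 0%N) ?size_iota ?nth_iota //; try lia.
by move=> E; exists i, j.
Qed.

Section Torsion.
Variable X : tree.
Implicit Types (x y z : X) (g h : aut X).

Lemma aut_exp_fix g x k i : (g ^+ k)%g x = x -> (g ^+ (i * k))%g x = x.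
Proof.
move=> gx; elim: i => [|i IH]; first by rewrite mul0n.
by rewrite mulSn expgnDr /= IH.
Qed.

(** Induction along the geodesic from a fixed vertex: a power that fixes [r n] permutes its finitely
    many neighbours, so a further power fixes [r n.+1]. *)
Lemma aut_exp_period g x : locally_finite X -> elliptic g ->
  exists2 k, (0 < k)%N & (g ^+ k)%g x = x.
Proof.
move=> lfX [x0 gx0]; have [r [red_r r0 <-]] := distP x0 x.
have [adj_r _] := red_r; move: (dist _ _) adj_r => n; elim: n => [|n IH] adj_r.
  by exists 1%N; rewrite // r0.
have [i lt_i|k k_gt0 gk] := IH; first by apply: adj_r; lia.
have [|i [j [ltij E]]] := @pigeonhole X [set y | adj (r n) y]
  (fun i => (g ^+ (i * k))%g (r n.+1)) (lfX (r n)).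
  by move=> i /=; rewrite -{1}(aut_exp_fix i gk) aut_adj adj_r.
exists ((j - i) * k)%N; first by rewrite muln_gt0 subn_gt0 ltij.
apply: (can_inj (aut_funK (g ^+ (i * k))%g)); rewrite E.
rewrite -[LHS]/((g ^+ (i * k) * g ^+ ((j - i) * k))%g (r n.+1)) -expgnDr.
by rewrite -mulnDl subnKC 1?ltnW.
Qed.

(** A common multiple of the periods of the vertices of the finite subtree given by discreteness
    yields a power fixing that subtree, hence trivial. *)
Lemma elliptic_finite_order (G : set (aut X)) g : locally_finite X ->
  discrete G -> (forall n, G (g ^+ n)%g) -> elliptic g ->
  exists2 n, (0 < n)%N & (g ^+ n = 1)%g.
Proof.
move=> lfX [T [/finite_seqP[s ->] _ trivG]] Gg ellg.
suff [n n_gt0 Hn] : exists2 n, (0 < n)%N & forall x, x \in s -> (g ^+ n)%g x = x.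
  by exists n => //; apply: trivG.
elim: s {trivG} => [|x s [n n_gt0 Hn]]; first by exists 1%N.
have [k k_gt0 Hk] := aut_exp_period x lfX ellg.
exists (n * k)%N; first by rewrite muln_gt0 n_gt0.
move=> y; rewrite inE => /orP[/eqP->|/Hn]; first exact: aut_exp_fix.
by rewrite mulnC; apply: aut_exp_fix.
Qed.

Lemma elliptic_not_free (S : set (aut X)) g : locally_finite X ->
  discrete (generated S) -> generated S g -> elliptic g -> g <> 1%g ->
  ~ is_free (generated S).
Proof.
move=> lfX dG Gg ellg g1 frG; apply: g1.
have [n n_gt0 gn] := elliptic_finite_order lfX dG (fun n => generatedX n Gg) ellg.
exact: free_torsion_free frG Gg n_gt0 gn.
Qed.

End Torsion.

(** * Schottky pairs from half-trees, and ping-pong *)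

Section Schottky.
Variable X : tree.
Implicit Types (x y z : X) (f : int -> X) (a b g h : aut X).

Lemma schottky_data_halftree g x y : adj x y ->
  schottky_data g [set g x; g y] [set x; y] (halftree (g x) (g y)) (halftree y x).
Proof.
move=> xy; have yx : adj y x by rewrite adj_sym.
have gxy : adj (g x) (g y) by rewrite aut_adj.
split; split.
- by exists (g x), (g y).
- by exists x, y.
- by rewrite image_setU !image_set1.
- exact: component_halftree.
- by rewrite setUC; apply: component_halftree.
- by rewrite setC_halftree // halftree_aut.
- rewrite setC_halftree //; have := @halftree_aut X (g^-1)%g (g y) (g x).
  by rewrite /= !aut_funK.
Qed.

(** The half-trees of the fundamental segment that begins at [f s]: beyond its last edge, or beyond
    the edge preceding [f s]. The offset [m.-1] makes a translation by [m] carry the second edge to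
    the first. *)
Definition side f s m (pos : bool) : set X :=
  let i := if pos then m.-1 else 0%N in
  halftree (f (s + along pos i)) (f (s + along pos i.+1)).

Lemma schottky_lines a b f1 f2 m n s t :
  translates a f1 m -> translates b f2 n ->
  (forall pos pos', side f1 s m pos `&` side f2 t n pos' = set0) ->
  schottky_pair a b.
Proof.
move=> af1 bf2 disj.
have [line1 m_gt0 aE] := af1; have [line2 n_gt0 bE] := bf2.
have self g f k u : translates g f k -> side f u k true `&` side f u k false = set0.
  move=> [linef _ _]; apply: half_lines_disjoint => // /(line_inj linef).
  by rewrite /along; lia.
have data g f k u : translates g f k ->
    schottky_data g [set f (u + along true k.-1); f (u + along true k.-1.+1)]
      [set f (u + along false 1); f (u + along false 0)]
      (side f u k true) (side f u k false).
  move=> [linef k_gt0 gE].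
  have /(@schottky_data_halftree g) : adj (f (u + along false 1)) (f (u + along false 0)).
    by have [+ _] := linef (u + along false 1); congr adj; congr f; rewrite /along; lia.
  rewrite !gE.
  have -> : u + along false 1 + k%:Z = u + along true k.-1 by rewrite /along; lia.
  by have -> : u + along false 0 + k%:Z = u + along true k.-1.+1 by rewrite /along; lia.
have side_neq0 f k u pos : line f -> side f u k pos !=set0.
  move=> linef; rewrite /side; move: (if pos then _ else _) => i.
  exists (f (u + along pos i.+1)).
  rewrite /halftree /= !(dist_line _ _ linef) /along.
  by case: pos; lia.
split; [by have [] := translates_axis af1 | by have [] := translates_axis bf2 |].
do 4 eexists; exists (side f1 s m true), (side f1 s m false),
  (side f2 t n true), (side f2 t n false); split; [exact: data af1 | exact: data bf2 | | |].
- by split; apply: side_neq0.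
- by split; [exact: self af1 | exact: disj | exact: disj].
- by split; [exact: disj | exact: disj | exact: self bf2].
Qed.

(** Both fundamental segments begin at the ends of a shortest bridge [r] between the lines; the
    half-trees of the two lines then lie in different directions as seen from the bridge. *)
Lemma schottky_disjoint_lines a b f1 f2 m n :
  translates a f1 m -> translates b f2 n ->
  edge_disjoint (range f1) (range f2) -> schottky_pair a b.
Proof.
move=> af1 bf2 disj; have [line1 m_gt0 aE] := af1; have [line2 n_gt0 bE] := bf2.
have [[[s t] _ Est] minst] := @nat_minP
  (range (fun st : int * int => dist (f1 st.1) (f2 st.2)))
  (dist (f1 0) (f2 0)) (@imageP _ _ _ _ (0, 0) I).
have {}minst s' t' : (dist (f1 s) (f2 t) <= dist (f1 s') (f2 t'))%N.
  by rewrite [X in (X <= _)%N]Est; apply: minst; exists (s', t').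
have [r [red_r r0 rd]] := distP (f1 s) (f2 t).
have dist_r i j : (i <= j <= dist (f1 s) (f2 t))%N -> dist (r i) (r j) = (j - i)%N.
  move=> le_ij; have le_d : (i + (j - i) <= dist (f1 s) (f2 t))%N by lia.
  have := dist_reduced (reduced_shift red_r le_d).
  by rewrite addn0 subnKC; lia.
have r1 : (0 < dist (f1 s) (f2 t))%N -> ~ range f1 (r 1%N).
  move=> d_gt0 [s' _ Es]; have := minst s' t.
  by rewrite Es -{2}rd dist_r; lia.
have rd1 : (0 < dist (f1 s) (f2 t))%N -> ~ range f2 (r (dist (f1 s) (f2 t) - 1)%N).
  move=> d_gt0 [t' _ Et]; have := minst s t'.
  by rewrite Et -{2}r0 dist_r; lia.
apply: (schottky_lines (s := s) (t := t) af1 bf2) => pos pos'; rewrite /side.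
set i := if pos then _ else _; set j := if pos' then _ else _.
have red1 : reduced (fun i => f1 (s + along pos i)) i.+1 by apply: reduced_line.
have red2 : reduced (gluepath (fun i => r (dist (f1 s) (f2 t) - i)%N)
   (dist (f1 s) (f2 t)) (fun i => f2 (t + along pos' i))) (dist (f1 s) (f2 t) + j.+1).
  apply: reduced_gluepath; [exact: reduced_rev | exact: reduced_line | |].
    by rewrite subn0 rd /along; case: pos' {j}; rewrite ?oppr0 addr0.
  by move=> d_gt0 _ E; apply: (rd1 d_gt0); rewrite E; exists (t + along pos' 1).
have along0 p : along p 0 = 0 by case: p.
rewrite addnS in red2; have := halftree_disjoint red1 red2; cbv beta.
rewrite gluepath0 subnn r0 along0 addr0 => /(_ erefl).
rewrite -addnS !gluepathR ?subn0 ?rd ?along0 ?addr0 //; apply.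
(* For a bridge of positive length, minimality keeps its interior off the lines. If the lines meet,
   two equal first steps would be a shared edge. *)
have [d0|d_gt0 E] := posnP (dist (f1 s) (f2 t)); last first.
  apply: (r1 d_gt0); exists (s + along pos 1) => //.
  by rewrite E /gluepath d_gt0 subKn.
rewrite d0 -[1%N]add0n gluepathR ?subn0; last by rewrite along0 addr0 -rd d0.
move=> E; suff : (edges (range f1) `&` edges (range f2)) [set f1 s; f1 (s + along pos 1)].
  by rewrite disj.
have adj1 : adj (f1 s) (f1 (s + along pos 1)).
  by have [/(_ 0%N isT)] := red1; rewrite along0 addr0.
split; exists (f1 s), (f1 (s + along pos 1)); split=> //.
- by exists t => //; apply/esym/dist_eq0.
- by exists (t + along pos' 1).
Qed.

Lemma disjointP (A B : set X) x : A `&` B = set0 -> A x -> B x -> False.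
Proof. by move=> AB Ax Bx; have : (A `&` B) x by []; rewrite AB. Qed.

(** Ping-pong: each letter [u] sends everything outside the half-tree of its inverse into its own
    half-tree [H u]. *)
Lemma schottky_free a b : schottky_pair a b ->
  is_free_of_rank 2 (generated [set a; b]).
Proof.
move=> [_ _ [e1p [e1m [e2p [e2m [H1p [H1m [H2p [H2m]]]]]]]]].
move=> [[_ [_ _ a1 a2]] [_ [_ _ b1 b2]] [p1 n1 p2 n2] [d1 d2 d3] [d4 d5 d6]].
(* Distinctness is part of the rank: the basis must have two elements. *)
have ab : a <> b.
  move=> ab; have [x xP] := p1.
  have nx1 : (~` H1m) x by move=> /(disjointP d1 xP).
  have nx2 : (~` H2m) x by move=> /(disjointP d3 xP).
  apply: (@disjointP H1p H2p (a x)) => //; first by rewrite -a1; exists x.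
  by rewrite -b1 -ab; exists x.
pose H (u : aut X * bool) := if u.1 == a then (if u.2 then H1p else H1m)
  else (if u.2 then H2p else H2m).
pose ok (u : aut X * bool) := [set a; b] u.1.
pose inv (u : aut X * bool) := (u.1, ~~ u.2).
have ba : (b == a) = false by apply/eqP => /esym.
have H_neq0 u : H u !=set0 by rewrite /H; do 2 case: ifP.
have H_disj u v : ok u -> ok v -> u <> v -> H u `&` H v = set0.
  move: u v => [u c] [v d]; rewrite /ok /H /=.
  move=> [] -> [] ->; rewrite ?eqxx ?ba; case: c d => -[] // _;
  by [| rewrite setIC].
have act u x : ok u -> ~ H (inv u) x -> H u (letter_eval u x).
  move: u => [u c]; rewrite /ok /H /inv /letter_eval /=.
  move=> [] ->; rewrite ?eqxx ?ba; case: c => /= nx.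
  - by rewrite -a1; exists x.
  - by rewrite -a2; exists x.
  - by rewrite -b1; exists x.
  - by rewrite -b2; exists x.
exists [set a; b]; split; last split=> //.
  have -> : [set a; b] = [set (if i == 0%N then a else b) | i in `I_2].
    apply/seteqP; split=> [_ [->|->]|_ [i _ <-]]; first by exists 0%N.
      by exists 1%N.
    by case: ifP; [left | right].
  apply: inj_card_eq => i j; rewrite !in_setE /=.
  by case: i j => [|[|i]] [|[|j]] //= _ _ E; case: ab.
move=> [//|u w] _ okw red_w E.
have act_w x : ~ H (inv (last u w)) x -> H u (word_eval (u :: w) x).
  elim: w u {E} okw red_w => [|v w IH] u okw red_w nx.
    rewrite word_eval_cons /word_eval big_nil mulg1; apply: act nx.
    by apply: (okw u); rewrite inE.
  rewrite word_eval_cons; change (H u (letter_eval u (word_eval (v :: w) x))).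
  have oku : ok u by apply: okw; rewrite inE eqxx.
  have okv : ok v by apply: okw; rewrite !inE eqxx orbT.
  have [uv red_vw] : letter_rel u v /\ reduced_word (v :: w) by apply/andP.
  have okvw v' : v' \in v :: w -> ok v'.
    by move=> zw; apply: okw; rewrite inE zw orbT.
  apply: act => // Hx; apply: (disjointP _ Hx (IH v okvw red_vw nx)).
  apply: H_disj => // E; move: uv.
  by rewrite -E /letter_rel /= eqxx; case: u.2.
(* At most two letters are forbidden, so one of any three is left. A point of [H v] is moved into
   [H u], which is disjoint from [H v]; hence the word is not trivial. *)
have [v [okv vu vl]] : exists v, [/\ ok v, v <> u & v <> inv (last u w)].
  have /allPn[v vS] : ~~ all (mem [:: u; inv (last u w)])
      [:: (a, true); (a, false); (b, true)].
    apply/negP => /allP/uniq_leq_size; suff U : uniq [:: (a, true); (a, false); (b, true)].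
      by move/(_ U).
    by rewrite /= !inE !xpair_eqE (eq_sym a b) ba !andbF.
  rewrite !inE negb_or => /andP[/eqP vu /eqP vl]; exists v; split=> //.
  by move: vS; rewrite /ok !inE => /or3P[] /eqP->; [left|left|right].
have [x vx] := H_neq0 v.
have okl : ok (last u w) by apply: okw; apply: mem_last.
apply: (@disjointP (H u) (H v) x) => //.
  by apply: H_disj => //; [apply: okw; rewrite inE eqxx | apply: nesym].
have := act_w x; rewrite E; apply.
by apply: (disjointP (H_disj v _ okv _ vl) vx).
Qed.

End Schottky.

(** * Counting the edges of segments and rays of a line *)

Section Ell.
Variable X : tree.
Implicit Types (f : int -> X).

Definition line_edge f (i : nat) : set X := [set f i%:Z; f i.+1%:Z].

Lemma line_edge_inj f : line f -> injective (line_edge f).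
Proof.
move=> linef i j E; have [[E1 E2]|[E1 E2]] := set2_eq E;
  by have := line_inj linef E1; have := line_inj linef E2; lia.
Qed.

Lemma edges_line f (D : set nat) : line f -> (forall i, D i.+1 -> D i) ->
  edges [set f i%:Z | i in D] = [set line_edge f i | i in [set i | D i.+1]].
Proof.
move=> linef Dd; have adjS i : adj (f i%:Z) (f i.+1%:Z).
  by have [+ _] := linef i%:Z; congr adj; congr f; lia.
apply/seteqP; split=> [e [_ [_ [[i Di <-] [j Dj <-] ij ->]]]|_ [i Di <-]].
  have := dist_adj ij; rewrite (dist_line _ _ linef) => dij.
  have [E|E] : j = i.+1 \/ i = j.+1 by lia.
    by exists i; rewrite /line_edge /= -?E.
  by exists j; rewrite /line_edge /= -?E // setUC.
exists (f i%:Z), (f i.+1%:Z); split=> //; [exists i | exists i.+1] => //.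
exact: Dd.
Qed.

Lemma ell_line f d : line f -> ell [set f i%:Z | i in [set i | (i <= d)%N]] = (d%:R)%:E.
Proof.
move=> linef; rewrite /ell edges_line //; last by move=> i /= /ltnW.
have card_d : ([set line_edge f i | i in [set i | (i < d)%N]] #= `I_d)%card.
  by apply: inj_card_eq => i j _ _; apply: line_edge_inj.
rewrite ifT; last by apply/asboolP/finite_setP; exists d.
by rewrite (card_fset_set card_d).
Qed.

Lemma ell_line_infinite f : line f -> ell [set f i%:Z | i in [set: nat]] = +oo%E.
Proof.
move=> linef; rewrite /ell edges_line //= ifF //; apply/negbTE/asboolPn.
rewrite (_ : [set _ | True] = setT) //.
rewrite (eq_finite_set (inj_card_eq _)); first exact: infinite_nat.
by move=> i j _ _; apply: line_edge_inj.
Qed.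

(** [D] is an initial segment of the naturals, so its image is a ray or a finite segment. This is
    how the length [l_0] is read off later. *)
Lemma ell_initial f (D : set nat) (e := ell [set f i%:Z | i in D]) : line f -> D 0%N ->
  (forall i, D i.+1 -> D i) ->
  ((forall i, D i) /\ e = +oo%E) \/
  exists d, [/\ D d, ~ D d.+1 & e = (d%:R)%:E].
Proof.
move=> linef D0 Dd; have [allD|/existsNP[n nDn]] := pselect (forall i, D i).
  left; split=> //; rewrite /e (_ : D = setT) ?ell_line_infinite //.
  by apply/seteqP; split.
right; elim: n nDn => // n IH nDn1.
have [Dn|/IH//] := pselect (D n); exists n; split=> //.
rewrite /e (_ : D = [set i | (i <= n)%N]) ?ell_line //.
apply/seteqP; split=> i /=.
  move=> Di; rewrite leqNgt; apply/negP => lt_ni; apply: nDn1.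
  by rewrite -(subnKC lt_ni) in Di; elim: (i - _)%N Di => [|k IHk]; rewrite ?addn0 // addnS => /Dd.
by move=> le_in; rewrite -(subnKC le_in) in Dn; elim: (n - i)%N Dn => [|k IHk];
  rewrite ?addn0 // addnS => /Dd.
Qed.

End Ell.

(** * Overlapping axes and one step of the Euclidean algorithm *)

Section Overlap.
Variable X : tree.
Implicit Types (x y z : X) (f : int -> X) (a b g h : aut X).

Lemma along0 pos : along pos 0 = 0.
Proof. by case: pos. Qed.

Lemma alongP (t : int) : exists pos i, t = along pos i.
Proof. by case: t => n; [exists true, n | exists false, n.+1]. Qed.

Lemma reduced_fixed g (r : nat -> X) n : reduced r n ->
  g (r 0%N) = r 0%N -> g (r n) = r n -> forall i, (i <= n)%N -> g (r i) = r i.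
Proof.
move=> red_r g0 gn; have [] := reduced_unique (reduced_aut g red_r) red_r g0 gn.
by [].
Qed.

(** Both axes are parametrized in the direction of translation, with [v+] at 0 and [v-] at [- l].
    The two inequalities say that the lines diverge at both ends. *)
Definition overlap a b f1 f2 m n l : Prop :=
  [/\ translates a f1 m, translates b f2 n,
      forall t : int, - l%:Z <= t <= 0 -> f1 t = f2 t,
      f1 1 <> f2 1 & f1 (- l.+1%:Z) <> f2 (- l.+1%:Z)].

Lemma overlap_sym a b f1 f2 m n l :
  overlap a b f1 f2 m n l -> overlap b a f2 f1 n m l.
Proof.
by move=> [af1 bf2 E N1 N2]; split=> //; [move=> t /E | apply: nesym | apply: nesym].
Qed.

(** For these [t] the inverse of [b] moves the point into the overlap, where it also lies on the
    axis of [a]. *)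
Lemma overlap_div a b f1 f2 m n l t : overlap a b f1 f2 m n l ->
  n%:Z - l%:Z <= t <= n%:Z -> (a * b^-1)%g (f2 t) = f1 (t - n%:Z + m%:Z).
Proof.
move=> [[_ _ aE] bf2 E _ _] tP; rewrite -aE -[LHS]/(a (aut_inv b (f2 t))).
by rewrite (translates_inv t bf2) E //; lia.
Qed.

(** By [overlap_div], [c] shifts part of the overlap by [p] along [f1]; so the segment of [f1] from
    0 to [p] is fundamental for [c], and the new axis follows [f1] from [n - l] to [p]. *)
Lemma overlap_step a b f1 f2 m n l : overlap a b f1 f2 m n l ->
  (n < m)%N -> (n < l)%N ->
  exists f3, overlap (a * b^-1)%g b f3 f2 (m - n) n (l - n) /\ f3 0 = f1 0.
Proof.
move=> ov lt_nm lt_nl; have [[line1 m_gt0 aE] bf2 E N1 Nl] := ov.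
have [line2 n_gt0 bE] := bf2; pose c := (a * b^-1)%g; pose p := (m - n)%N.
have cf1 t : n%:Z - l%:Z <= t <= 0 -> c (f1 t) = f1 (t + p%:Z).
  by move=> tP; rewrite E ?(overlap_div ov); [congr f1; lia | lia..].
have red1 : reduced (fun i : nat => f1 i%:Z) p.
  apply: eq_reduced (reduced_line 0 true p line1) => i _.
  by rewrite add0r.
have [|||f3 [cf3 f3E]] := @translates_extend X c _ p _ red1; rewrite -?/p.
- lia.
- by rewrite cf1 ?add0r //; lia.
- have -> : p.-1%:Z = -1 + p%:Z by lia.
  by rewrite -cf1; [move/(can_inj (aut_funK c))/(line_inj line1); lia | lia].
have [line3 p_gt0 cE] := cf3.
have f13 i : (i <= l - n)%N -> f3 (- i%:Z) = f1 (- i%:Z).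
  elim/ltn_ind: i => i IH le_i; apply: (can_inj (aut_funK c)).
  rewrite cE cf1; last lia.
  have [le_ip|lt_pi] := leqP i p.
    have -> : - i%:Z + p%:Z = (p - i)%N by lia.
    by rewrite f3E //; lia.
  have -> : - i%:Z + p%:Z = - (i - p)%N%:Z by lia.
  by apply: IH; lia.
have f13' t : - (l - n)%N%:Z <= t <= p%:Z -> f3 t = f1 t.
  case: t => i tP; first by rewrite f3E //; lia.
  have -> : Negz i = - i.+1%:Z by lia.
  by apply: f13; lia.
exists f3; split; last by rewrite f13' //; lia.
split=> //.
- by move=> t tP; rewrite f13' ?E //; lia.
- by rewrite f13' //; lia.
(* At the backward end, [c] carries an agreement of the new axis with [f2] to the [a]-image of an
   agreement of [f1] and [f2] just before [v-]. *)
move=> /(congr1 c); rewrite cE f13'; last lia.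
rewrite /c /= (translates_inv _ bf2).
have -> : - (l - n).+1%:Z + p%:Z = - l.+1%:Z + m%:Z by lia.
have -> : - (l - n).+1%:Z - n%:Z = - l.+1%:Z by lia.
by rewrite -aE => /(can_inj (aut_funK a)).
Qed.

Lemma overlap_shared_edge a b f1 f2 m n l : overlap a b f1 f2 m n l -> (0 < l)%N ->
  ~ edge_disjoint (axis a) (axis b).
Proof.
move=> [af1 bf2 E _ _] l_gt0; have [line1 _ _] := af1.
have [_ _ ->] := translates_axis af1; have [_ _ ->] := translates_axis bf2 => disj.
suff : (edges (range f1) `&` edges (range f2)) [set f1 (-1); f1 0] by rewrite disj.
have adj1 : adj (f1 (-1)) (f1 0) by have [+ _] := line1 (-1); rewrite addrC subrr.
split; exists (f1 (-1)), (f1 0); split=> //.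
  by exists (-1) => //; rewrite E //; lia.
by exists 0 => //; rewrite E //; lia.
Qed.

Lemma overlap_endpoint a b f1 f2 m n l : overlap a b f1 f2 m n l -> (0 < l)%N ->
  endpoint (f1 0) (axis a `&` axis b).
Proof.
move=> [af1 bf2 E N1 _] l_gt0; have [line1 _ _] := af1; have [line2 _ _] := bf2.
have [_ _ ->] := translates_axis af1; have [_ _ ->] := translates_axis bf2.
have E0 : f1 0 = f2 0 by apply: E; lia.
have E1 : f1 (-1) = f2 (-1) by apply: E; lia.
split; first by split; exists 0.
exists (f1 (-1)); split.
  split; first by split; exists (-1).
  by have [+ _] := line1 (-1); rewrite addrC subrr adj_sym.
move=> x [[x1 x2] adjx]; have := line_neighbor line1 adjx x1.
rewrite E0 in adjx; have := line_neighbor line2 adjx x2.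
by rewrite !add0r => -[] -> [] // /esym.
Qed.

(** Both fundamental segments begin at [v-]. Being longer than the overlap, they end on diverging
    branches beyond [v+]; backwards the lines diverge at [v-]. *)
Lemma overlap_schottky a b f1 f2 m n l : overlap a b f1 f2 m n l ->
  (0 < l)%N -> (l < m)%N -> (l < n)%N -> schottky_pair a b.
Proof.
move=> [af1 bf2 E N1 Nl] l_gt0 lt_lm lt_ln.
have [line1 m_gt0 _] := af1; have [line2 n_gt0 _] := bf2.
have El : f1 (- l%:Z) = f2 (- l%:Z) by apply: E; lia.
have El1 : f1 (- l%:Z + 1) = f2 (- l%:Z + 1) by apply: E; lia.
apply: (schottky_lines (s := - l%:Z) (t := - l%:Z) af1 bf2) => -[] [].
(* The forward half-trees are re-indexed from [v+], where the lines separate. *)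
- have shift k f : (l < k)%N -> side f (- l%:Z) k true =
      halftree (f (0 + along true (k.-1 - l))) (f (0 + along true (k.-1 - l).+1)).
    by move=> lt_lk; rewrite /side /along; congr (halftree (f _) (f _)); lia.
  rewrite !shift //; apply: half_lines_disjoint => //.
    by apply: E; lia.
- apply: half_lines_disjoint => //; rewrite El1 => /(line_inj line2).
  by rewrite /along; lia.
- apply: half_lines_disjoint => //; rewrite -El1 => /(line_inj line1).
  by rewrite /along; lia.
- apply: half_lines_disjoint => //=.
  by have -> : - l%:Z + along false 1 = - l.+1%:Z by rewrite /along; lia.
Qed.

(** With equal translation lengths [overlap_div] gives fixed points. A further one on the line
    would, by convexity, force the vertex next to an end of the interval to be fixed, against the
    divergence of the lines. *)
Lemma overlap_fixed a b f1 f2 n l t : overlap a b f1 f2 n n l -> (n <= l)%N ->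
  (a * b^-1)%g (f2 t) = f2 t <-> n%:Z - l%:Z <= t <= 0.
Proof.
move=> ov le_nl; have [[line1 n_gt0 aE] bf2 E N1 Nl] := ov.
have [line2 _ _] := bf2; pose c := (a * b^-1)%g.
have fixed s : n%:Z - l%:Z <= s <= 0 -> c (f2 s) = f2 s.
  by move=> sP; rewrite (overlap_div ov) ?subrK ?E //; lia.
have spread s pos i : n%:Z - l%:Z <= s <= 0 -> c (f2 (s + along pos i.+1)) =
    f2 (s + along pos i.+1) -> c (f2 (s + along pos 1)) = f2 (s + along pos 1).
  move=> /fixed cs ci.
  apply: (reduced_fixed (reduced_line s pos i.+1 line2)) => //.
  by rewrite along0 addr0.
split=> [ct|/fixed//]; apply: contrapT => Nt.
have [t_gt0|t_lt] : 0 < t \/ t < n%:Z - l%:Z by lia.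
  have := @spread 0 true `|t|%N.-1.
  rewrite !add0r (_ : along true _.+1 = t); last by rewrite /along; lia.
  rewrite (_ : along true 1 = 1) // (overlap_div (t := 1) ov) ?subrK; last lia.
  by move=> /(_ _ ct) N; apply: N1; apply: N; lia.
have := @spread (n%:Z - l%:Z) false (absz (n%:Z - l%:Z - t)%R).-1.
rewrite (_ : n%:Z - l%:Z + along false _.+1 = t); last by rewrite /along; lia.
move=> /(_ _ ct) N; apply: Nl; apply: (can_inj (aut_funK a)).
rewrite aE E; last lia.
have Es : - l.+1%:Z + n%:Z = n%:Z - l%:Z + along false 1 by rewrite /along; lia.
rewrite Es -N /c /=; last lia.
by rewrite (translates_inv _ bf2); congr (a (f2 _)); rewrite /along; lia.
Qed.

Lemma overlap_elliptic a b f1 f2 n l : overlap a b f1 f2 n n l -> (n < l)%N ->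
  [/\ elliptic (a * b^-1)%g, (a * b^-1)%g <> 1%g,
      ~ edge_disjoint (axis b) (fixed_subtree (a * b^-1)%g) &
      endpoint (f1 0) (axis b `&` fixed_subtree (a * b^-1)%g)].
Proof.
move=> ov lt_nl; have [_ bf2 E _ _] := ov; have [line2 n_gt0 _] := bf2.
have fixE t := overlap_fixed t ov (ltnW lt_nl).
have fix0 : (a * b^-1)%g (f2 0) = f2 0 by apply/fixE; lia.
have fix1 : (a * b^-1)%g (f2 (-1)) = f2 (-1) by apply/fixE; lia.
have nfix1 : (a * b^-1)%g (f2 1) <> f2 1 by move/fixE; lia.
have adj1 : adj (f2 0) (f2 (-1)).
  by have [+ _] := line2 (-1); rewrite addrC subrr adj_sym.
have [_ _ ->] := translates_axis bf2.
rewrite (_ : f1 0 = f2 0); last by apply: E; lia.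
split; first by exists (f2 0).
- by move=> c1; apply: nfix1; rewrite c1.
- move=> disj.
  suff : (edges (range f2) `&` edges (fixed_subtree (a * b^-1)%g)) [set f2 0; f2 (-1)].
    by rewrite disj.
  by split; exists (f2 0), (f2 (-1)).
split; first by split=> //; exists 0.
exists (f2 (-1)); split; first by split=> //; split=> //; exists (-1).
move=> x [[x2 xfix] adjx]; have := line_neighbor line2 adjx x2.
by rewrite !add0r => -[E1|//]; case: nfix1; rewrite -E1.
Qed.

End Overlap.

(** * The boundary case: an overlap exactly as long as the translation length of [b] *)

Section Abutting.
Variables (X : tree) (a b : aut X) (f1 f2 : int -> X) (p n : nat).
Hypothesis ov : overlap a b f1 f2 (p + n) n n.

Let c := (a * b^-1)%g.

(* At v+ the line b f1 passes backwards along f1 over i edges. *)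
Let folded (i : nat) := f1 i%:Z = b (f1 (- (n + i)%N%:Z)).

Let af1 : translates a f1 (p + n). Proof. by case: ov. Qed.
Let bf2 : translates b f2 n. Proof. by case: ov. Qed.
Let line1 : line f1. Proof. by case: af1. Qed.
Let line2 : line f2. Proof. by case: bf2. Qed.
Let n_gt0 : (0 < n)%N. Proof. by case: bf2. Qed.
Let aE t : a (f1 t) = f1 (t + (p + n)%N%:Z). Proof. by case: af1. Qed.
Let bE t : b (f2 t) = f2 (t + n%:Z). Proof. by case: bf2. Qed.
Let f12 t : - n%:Z <= t <= 0 -> f1 t = f2 t. Proof. by case: ov => _ _ + _ _; apply. Qed.
Let f12_1 : f1 1 <> f2 1. Proof. by case: ov. Qed.
Let f12_n : f1 (- n.+1%:Z) <> f2 (- n.+1%:Z). Proof. by case: ov. Qed.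

Let bline : line (fun t => b (f1 t)). Proof. exact: line_aut. Qed.

Let bf1 t : 0 <= t <= n%:Z -> b (f1 (- n%:Z + t)) = f2 t.
Proof. by move=> tP; rewrite f12 ?bE; [congr f2; lia | lia]. Qed.

Let b_origin : f1 0 = b (f1 (- n%:Z)).
Proof. by rewrite -[- n%:Z]addr0 bf1 ?f12 //; lia. Qed.

Let folded0 : folded 0.
Proof. by rewrite /folded addn0 b_origin. Qed.

Let folded_agree i : folded i -> forall k, (k <= i)%N -> folded k.
Proof.
move=> fi k le_ki.
have := @lines_agree X f1 (fun t => b (f1 t)) 0 (- n%:Z) true false i i
  line1 bline b_origin.
rewrite /along !add0r -!opprD => /(_ fi)[_ /(_ k le_ki)].
by rewrite /folded add0r => ->; congr (b (f1 _)); lia.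
Qed.

(** On the folded part [c] acts as the reflection of [f1] about [p / 2]. *)
Let foldedP i : folded i -> c (f1 i%:Z) = f1 (p%:Z - i%:Z).
Proof.
move=> ->; rewrite /c /= aut_funK aE; congr f1; lia.
Qed.

(** At [v+], neither [f1] forwards nor [b f1] backwards starts along the axis of [b]. *)
Let directions :
  [/\ f1 1 <> f2 1, f1 1 <> f2 (-1), b (f1 (- n.+1%:Z)) <> f2 1 &
      b (f1 (- n.+1%:Z)) <> f2 (-1)].
Proof.
split=> //.
- by rewrite -f12; [move/(line_inj line1) | lia].
- rewrite -(@bf1 1); last lia.
  by move=> /(can_inj (aut_funK b))/(line_inj line1); lia.
- have -> : f2 (-1) = b (f2 (- n.+1%:Z)) by rewrite bE; congr f2; lia.
  by move/(can_inj (aut_funK b)).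
Qed.

(** Both lines pass through [v+]. By [directions], the only rays from there that can share an edge
    are the forward one of [f1] and the backward one of [b f1]. *)
Lemma abutting_intersection :
  axis a `&` b @` axis a = [set f1 i%:Z | i in folded].
Proof.
have [N1 N1' Nn Nn'] := directions.
have [_ _ ->] := translates_axis af1; apply/seteqP; split=> x; last first.
  move=> [i fi <-]; split; first by exists i%:Z.
  by exists (f1 (- (n + i)%N%:Z)); [exists (- (n + i)%N%:Z) | rewrite -fi].
move=> [[s _ <-] [_ [u _ <-] E]].
have [pos [i Es]] := alongP s; have [pos' [j Eu]] := alongP (u + n%:Z).
have {Eu}Eu : u = - n%:Z + along pos' j by lia.
rewrite {}Eu {}Es in E *.
have bn1 : - n%:Z + along false 1 = - n.+1%:Z by rewrite /along; lia.
have [|Npos] := pselect (pos = true /\ pos' = false).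
  move=> [Epos Epos']; rewrite {}Epos {}Epos' in E *; exists i; last by [].
  have [] := @lines_agree X f1 (fun t => b (f1 t)) 0 (- n%:Z) true false i j
    line1 bline b_origin; first by rewrite add0r E.
  move=> _ /(_ i (leqnn i)); rewrite add0r /folded => ->.
  by congr (b (f1 _)); rewrite /along; lia.
have : dist (f1 (0 + along pos i)) (b (f1 (- n%:Z + along pos' j))) = (i + j)%N.
  apply: (@dist_lines X f1 (fun t => b (f1 t))) => //; rewrite add0r.
  case: pos pos' Npos {E} => -[] Npos.
  - by rewrite bf1; [ | rewrite /along; lia].
  - by case: Npos.
  - rewrite bf1; last by rewrite /along; lia.
    by rewrite f12 => [/(line_inj line2)|]; rewrite /along; lia.
  - by rewrite bn1 f12; [apply: nesym | rewrite /along; lia].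
rewrite add0r E distxx => ij; have -> : i = 0%N by lia.
by exists 0%N => //; rewrite along0.
Qed.

Let fixes_elliptic i : c (f1 i%:Z) = f1 i%:Z -> elliptic c.
Proof. by exists (f1 i%:Z). Qed.

(** The fold reaches the middle of the reflection, which is a fixed vertex, or a flipped edge if [p]
    is odd. *)
Lemma abutting_elliptic : (((p%:R / 2 : rat)%:E <= ell (axis a `&` b @` axis a))%E) ->
  ~ inversion c ->
  [/\ elliptic c, c <> 1%g & edge_disjoint (axis b) (fixed_subtree c)].
Proof.
move=> le_p ninv; rewrite abutting_intersection in le_p.
(* The bound [p.+1] covers both ends of the middle edge when [p] is odd. *)
have fold i : (i.*2 <= p.+1)%N -> folded i.
  move=> le_i.
  have := ell_initial line1 folded0 (fun i fi => folded_agree fi (leqnSn i)).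
  case=> [[]//|[d [fd _ E]]]; rewrite E lee_fin in le_p.
  apply: folded_agree fd _ _; suff : (p <= d.*2)%N by lia.
  rewrite -(ler_nat rat) -muln2 natrM; lra.
have p2 : p = (odd p + p./2.*2)%N by rewrite odd_double_half.
have fix_mid : c (f1 p./2) = f1 p./2.
  case: (boolP (odd p)) => odd_p in p2; last first.
    by rewrite foldedP; [congr f1; lia | apply: fold; lia].
  case: ninv; exists (f1 p./2%:Z), (f1 p./2.+1%:Z); split.
  - by have [+ _] := line1 p./2%:Z; congr adj; congr f1; lia.
  - by rewrite foldedP; [congr f1; lia | apply: fold; lia].
  - by rewrite foldedP; [congr f1; lia | apply: fold; lia].
have [_ _ ->] := translates_axis bf2.
(* If [p] is 0, the translation lengths agree and only [v+] is fixed on the axis of [b]. *)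
have [p0|p_gt0] := posnP p.
  have ov0 := ov; rewrite p0 add0n in ov0.
  have fixE t := overlap_fixed t ov0 (leqnn n).
  split; first exact: fixes_elliptic fix_mid.
    move=> c1; have : c (f2 1) = f2 1 by rewrite c1.
    by move/fixE; lia.
  rewrite /edge_disjoint -subset0 => e [[x [y [[s _ <-] [t _ <-] adjst Ee]]]].
  move=> [x' [y' [x'P y'P _ Ee']]].
  have sub z : e z -> fixed_subtree c z by rewrite Ee' => -[->|->].
  have /fixE : c (f2 s) = f2 s by apply: sub; rewrite Ee; left.
  have /fixE : c (f2 t) = f2 t by apply: sub; rewrite Ee; right.
  move=> tP sP; have st : s = t by lia.
  by move: adjst; rewrite st adj_irr.
have nfix0 : c (f1 0) <> f1 0.
  by rewrite foldedP // => /(line_inj line1); lia.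
split; first exact: fixes_elliptic fix_mid.
  by move=> c1; apply: nfix0; rewrite c1.
rewrite /edge_disjoint -subset0 => e [[_ [y [[s _ <-] _ _ Ee]]]].
move=> [x' [y' [x'P y'P _ Ee']]].
have fixs : c (f2 s) = f2 s.
  have : [set x'; y'] (f2 s) by rewrite -Ee' Ee; left.
  by move=> [->|->].
apply: nfix0; have [pos [i Es]] := alongP s; rewrite {}Es in fixs.
have [N1 N1' _ _] := directions.
(* The geodesic from the fixed middle to a fixed point on the axis of [b] passes through [v+], which
   would be fixed too. *)
have red : reduced (gluepath (fun i => f1 (0 + along true i)) p./2
    (fun i => f2 (0 + along pos i))) (p./2 + i).
  apply: reduced_gluepath; [exact: reduced_line | exact: reduced_line | |].
    by rewrite !along0 addr0 f12 //; lia.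
  by move=> _ _; rewrite !add0r; case: pos {fixs}.
have E0 : f1 (0 + along true 0) = f2 (0 + along pos 0).
  by rewrite !along0 addr0 f12 //; lia.
have := @reduced_fixed X c _ _ red; rewrite gluepath0 gluepathR // !add0r.
move=> /(_ fix_mid fixs p./2); rewrite leq_addr => /(_ isT).
by rewrite /gluepath leqnn subnn add0r.
Qed.

(** The fold ends at [f1 d], before the middle; [c] maps [f1 d] to [f1 (p - d)], and the segment
    between them, of [q = p - d.*2] edges, is fundamental for [c]. *)
Lemma abutting_hyperbolic : (ell (axis a `&` b @` axis a) < (p%:R / 2 : rat)%:E)%E ->
  schottky_pair c b /\ edge_disjoint (axis c) (axis b).
Proof.
rewrite abutting_intersection => lt_p.
have [d [fd nfd lt_dp]] : exists d, [/\ folded d, ~ folded d.+1 & (d.*2 < p)%N].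
  have := ell_initial line1 folded0 (fun i fi => folded_agree fi (leqnSn i)).
  case=> [[_ E]|[d [fd nfd E]]]; rewrite E // in lt_p.
  exists d; split=> //; rewrite lte_fin in lt_p.
  by rewrite -(ltr_nat rat) -muln2 natrM; lra.
pose q := (p - d.*2)%N.
have cE t : c (b (f1 t)) = f1 (t + (p + n)%N%:Z) by rewrite /c /= aut_funK aE.
have red1 : reduced (fun i => f1 (d%:Z + along true i)) q by apply: reduced_line.
have q_gt0 : (0 < q)%N by lia.
(* The last but one vertex of the segment is the image under [c] of the vertex of [b f1] just past
   the fold. Backtracking would therefore lengthen the fold. *)
have pd : d%:Z + along true q.-1 = - (n + d.+1)%N%:Z + (p + n)%N%:Z.
  by rewrite /along; lia.
have [||f3 [cf3 f3E]] := @translates_extend X c _ q q_gt0 red1.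
- by rewrite along0 addr0 foldedP //; congr f1; rewrite /along; lia.
- rewrite pd -cE => /(can_inj (aut_funK c)) E; apply: nfd.
  by rewrite /folded -E; congr f1; rewrite /along; lia.
have [line3 _ c3] := cf3.
have f3_1 : f3 1 = f1 d.+1%:Z.
  by rewrite f3E //; congr f1; rewrite /along; lia.
have f3_N1 : f3 (-1) = b (f1 (- (n + d.+1)%N%:Z)).
  apply: (can_inj (aut_funK c)); rewrite c3 cE -pd.
  by rewrite (_ : -1 + q%:Z = q.-1%:Z) ?f3E //; lia.
have [N1 N1' Nn Nn'] := directions.
(* Neither direction of the new axis at [f1 d] leads back towards [v+] or, if [d] is 0, along the
   axis of [b]. So distances to that axis add up through the fold. *)
have meet s t : f3 s = f2 t -> s = 0.
  have [pos [i ->]] := alongP s; have [pos' [j ->]] := alongP t => E.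
  pose r := gluepath (fun i => f1 (0 + along true i)) d
    (fun i => f2 (0 + along pos' i)).
  have E0 : f1 (0 + along true 0) = f2 (0 + along pos' 0).
    by rewrite !along0 addr0 f12 //; lia.
  have red_r : reduced r (d + j).
    apply: reduced_gluepath; [exact: reduced_line | exact: reduced_line | done |].
    by move=> _ _; rewrite !add0r; case: pos' {E r E0}.
  have := @dist_branch X (fun i => f3 (0 + along pos i)) i r (d + j)
    (reduced_line _ _ _ line3) red_r.
  rewrite /r gluepathR // gluepath0 !add0r along0 E distxx (f3E 0%N) // along0 addr0.
  move=> /(_ erefl) H; suff : 0%N = (i + (d + j))%N.
    move=> ij; have -> : i = 0%N by lia.
    by rewrite along0.
  apply: H => _ _; have [d0|d_gt0] := posnP d.
    rewrite d0 -{2}[1%N]add0n gluepathR // add0r.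
    case: pos {E} => /=; rewrite ?f3_1 ?f3_N1 d0 ?addn1; case: pos' {r E0 red_r} => //.
  rewrite /gluepath d_gt0 add0r; case: pos {E} => /=.
    by rewrite f3_1 => /(line_inj line1); rewrite /along; lia.
  rewrite f3_N1 (folded_agree fd (leq_subr 1 d)).
  by move=> /(can_inj (aut_funK b))/(line_inj line1); lia.
have disj : edge_disjoint (range f3) (range f2).
  rewrite /edge_disjoint -subset0 => e [[_ [_ [[s _ <-] [t _ <-] adjst Ee]]]].
  move=> [_ [_ [[s' _ <-] [t' _ <-] _ Ee']]]; rewrite Ee in Ee'.
  have [[E1 E2]|[E1 E2]] := set2_eq Ee'; move: adjst;
    by rewrite (meet _ _ E1) (meet _ _ E2) adj_irr.
split; first exact: schottky_disjoint_lines cf3 bf2 disj.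
by have [_ _ ->] := translates_axis cf3; have [_ _ ->] := translates_axis bf2.
Qed.

End Abutting.

(** * Common parametrization of the two given axes *)

Section InitialOverlap.
Variable X : tree.
Implicit Types (x y : X) (A B : set X) (g h : aut X).

Lemma edges_setI A B : edges (A `&` B) = edges A `&` edges B.
Proof.
apply/seteqP; split=> e.
  by move=> [x [y [[Ax Bx] [Ay By] xy ->]]]; split; exists x, y.
move=> [[x [y [Ax Ay xy Ee]]] [x' [y' [Bx By _ Ee']]]].
have sub z : e z -> B z by rewrite Ee' => -[->|->].
by exists x, y; split=> //; split=> //; apply: sub; rewrite Ee; [left | right].
Qed.

Lemma ell_edge_disjoint A B l : ell (A `&` B) = (l%:R)%:E ->
  edge_disjoint A B <-> l = 0%N.
Proof.
rewrite /ell /edge_disjoint -edges_setI.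
case: asboolP => // fin [/eqP]; rewrite eqr_nat => /eqP <-.
split=> [->|]; first by rewrite fset_set0 cardfs0.
by move/cardfs0_eq => E; rewrite -(fset_setK fin) E set_fset0.
Qed.

Lemma translates_toward_back g f m u : translates g f m ->
  translates_toward g (f u) (f 0) -> u = - (dist (f u) (f 0))%:Z.
Proof.
move=> gfm [n]; have [linef m_gt0 _] := gfm; rewrite /segment /= (translates_exp n gfm).
by rewrite !(dist_line _ _ linef); move: (n * m)%N => w; lia.
Qed.

(** Both axes are recentred at [vp]; the directions of translation put [vm] at the same negative
    parameter. Uniqueness of geodesics gives the agreement in between, and counting edges identifies
    the distance with [l]. *)
Lemma overlap_initial g h l vm vp : hyperbolic g -> hyperbolic h ->
  ell (axis g `&` axis h) = (l%:R)%:E ->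
  axis g `&` axis h = segment vm vp ->
  translates_toward g vm vp -> translates_toward h vm vp ->
  exists f1 f2, overlap g h f1 f2 (translation_length g) (translation_length h) l
    /\ f1 0 = vp.
Proof.
move=> /hyperbolic_translates[f1 gf1] /hyperbolic_translates[f2 hf2] ellE segE tg th.
have [_ _ axg] := translates_axis gf1; have [_ _ axh] := translates_axis hf2.
have [vpg vph] : (axis g `&` axis h) vp by rewrite segE /segment /= distxx addn0.
have [vmg vmh] : (axis g `&` axis h) vm by rewrite segE /segment /= distxx.
have recenter k f mk : translates k f mk -> axis k = range f -> axis k vp ->
    axis k vm -> translates_toward k vm vp -> exists f', [/\ translates k f' mk,
      axis k = range f', f' 0 = vp & f' (- (dist vm vp)%:Z) = vm].
  move=> kf axk; rewrite axk => -[t0 _ Et0] [u0 _ Eu0] tk.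
  exists (fun t => f (t0 + t)); have kf' := translates_shift t0 kf.
  have Eu : vm = f (t0 + (u0 - t0)) by rewrite subrKC.
  have Et : vp = f (t0 + 0) by rewrite addr0.
  split=> //.
    apply/seteqP; split=> _ [t _ <-]; first by exists (t - t0); rewrite // subrKC.
    by exists (t0 + t).
  by rewrite Eu Et in tk *; rewrite -(translates_toward_back kf' tk).
have {vpg vmg tg gf1 axg}[{}f1 [gf1 axg f10 f1d]] := recenter _ _ _ gf1 axg vpg vmg tg.
have {vph vmh th hf2 axh recenter}[{}f2 [hf2 axh f20 f2d]] :=
  recenter _ _ _ hf2 axh vph vmh th.
have [line1 _ _] := gf1; have [line2 _ _] := hf2; set d := dist vm vp in f1d f2d.
have agree t : - d%:Z <= t <= 0 -> f1 t = f2 t.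
  move=> tP; have := @lines_agree X f1 f2 0 0 false false d d line1 line2.
  rewrite f10 f20 !add0r f1d f2d => /(_ erefl erefl)[_ /(_ `|t|%N)].
  rewrite !add0r (_ : along false _ = t) /along; last lia.
  by apply; lia.
have inseg t : f1 t = f2 t -> - d%:Z <= t <= 0.
  move=> E; have : segment vm vp (f1 t).
    by rewrite -segE axg axh; split; [exists t | exists t].
  by rewrite /segment /= -/d -f1d -f10 !(dist_line _ _ line1); lia.
suff Ed : l = d.
  exists f1, f2; split=> //; rewrite Ed; split=> //; by [move/inseg; lia].
suff : ell (axis g `&` axis h) = d%:R%:E.
  by rewrite ellE => -[/eqP]; rewrite eqr_nat => /eqP.
rewrite -(ell_line d (line_shift (- d%:Z) line1)); congr ell.
apply/seteqP; split=> x.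
  move=> [xg xh]; have : segment vm vp x by rewrite -segE.
  move: xg; rewrite axg => -[t _ <-].
  rewrite /segment /= -/d -f1d -f10 !(dist_line _ _ line1) => tP.
  by exists (absz (t + d%:Z)%R) => /=; [lia | congr f1; lia].
move=> [i /= le_id <-]; rewrite axg axh; split; first by exists (- d%:Z + i%:Z).
by exists (- d%:Z + i%:Z) => //; rewrite agree //; lia.
Qed.

End InitialOverlap.

(** * The Euclidean algorithm on the pair of generators *)

Lemma expgN_S (G : groupType) (x y : G) q : (x * y ^- q * y^-1 = x * y ^- q.+1)%g.
Proof. by rewrite -mulgA -invgM -expgS. Qed.

Section Euclid.
Variables (X : tree) (gam : nat -> aut X) (m qs : nat -> nat) (k : nat).
Hypothesis m12 : (0 < m 2 <= m 1)%N.
Hypothesis eucl : euclidean_sequences k m qs gam.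

Let m_gt0 i : (1 <= i <= k)%N -> (0 < m i)%N. Proof. by case: eucl => + _ _; apply. Qed.
Let mk1 : m k.+1 = 0%N. Proof. by case: eucl. Qed.
Let qsE i : (1 <= i <= k.-1)%N -> qs i = (m i %/ m i.+1)%N.
Proof. by case: eucl => _ _ rec /rec[]. Qed.
Let mE i : (1 <= i <= k.-1)%N -> m i.+2 = (m i - qs i * m i.+1)%N.
Proof. by case: eucl => _ _ rec /rec[]. Qed.

Lemma euclid_k_gt1 : (1 < k)%N.
Proof.
case: k mk1 => [|[|//]] E; first by move: m12; rewrite E; lia.
by move: m12; rewrite E.
Qed.

Lemma euclid_mod i : (1 <= i <= k.-1)%N -> m i.+2 = (m i %% m i.+1)%N.
Proof.
by move=> iP; rewrite mE // qsE // {1}(divn_eq (m i) (m i.+1)) addKn.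
Qed.

Lemma euclid_eq i : (1 <= i <= k.-1)%N -> m i = (qs i * m i.+1 + m i.+2)%N.
Proof. by move=> iP; rewrite euclid_mod // qsE // -divn_eq. Qed.

Lemma euclid_lt i : (1 <= i <= k.-1)%N -> (m i.+2 < m i.+1)%N.
Proof. by move=> iP; rewrite euclid_mod // ltn_mod m_gt0 //; lia. Qed.

Lemma euclid_quot_gt0 i : (1 <= i <= k.-1)%N -> (0 < qs i)%N.
Proof.
move=> iP; rewrite qsE // divn_gt0 ?m_gt0 //; last lia.
case: i iP => [|[|i]] // iP; first by case/andP: m12.
by apply/ltnW/euclid_lt; lia.
Qed.

Lemma euclid_gcd : gcdn (m 1) (m 2) = m k.
Proof.
have H i : (i < k)%N -> gcdn (m 1) (m 2) = gcdn (m i.+1) (m i.+2).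
  elim: i => // i IH lt_i; rewrite IH; last lia.
  by rewrite (@euclid_mod i.+1) ?gcdn_modr 1?gcdnC //; lia.
have k_gt1 := euclid_k_gt1.
by rewrite (H k.-1) ?prednK ?mk1 ?gcdn0 //; lia.
Qed.

(* The window of (j, q) in terms of D = m_1 + m_2 - l, with terms moved so that
   no truncated subtraction occurs. *)
Definition euclid_window (D j q : nat) : Prop :=
  [/\ (m j <= D + q * m j.+1)%N, (D + q * m j.+1 < m j + m j.+1)%N,
      (1 <= j <= k.-1)%N & (q < qs j)%N].

Lemma euclid_sum_anti i j : (1 <= i)%N -> (i <= j <= k)%N ->
  (m j + m j.+1 <= m i + m i.+1)%N.
Proof.
move=> i_gt0 /andP[le_ij le_jk]; rewrite -(subnKC le_ij).
move: le_jk; rewrite -{1}(subnKC le_ij); elim: (j - i)%N => [|d IH] le_k.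
  by rewrite addn0.
apply: leq_trans (IH _); last lia.
rewrite addnS (@euclid_eq (i + d)); last lia.
have := @euclid_quot_gt0 (i + d); nia.
Qed.

(** For the least [j] with [m j.+1 + m j.+2 <= D], also [D < m j + m j.+1]. This range has length
    [qs j * m j.+1] and is cut into [qs j] blocks of length [m j.+1], which are the windows. *)
Lemma euclid_window_exists D : (m k <= D)%N -> (D < m 1 + m 2)%N ->
  exists j q, euclid_window D j q.
Proof.
move=> le_D lt_D; have k_gt1 := euclid_k_gt1.
have exj : exists j, (0 < j)%N && (m j.+1 + m j.+2 <= D)%N.
  by exists k.-1; rewrite prednK ?mk1 ?addn0 ?le_D; lia.
pose j := ex_minn exj; have [j_gt0 le_jD minj] : [/\ (0 < j)%N, (m j.+1 + m j.+2 <= D)%N &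
    forall i, (0 < i)%N && (m i.+1 + m i.+2 <= D)%N -> (j <= i)%N].
  by rewrite /j; case: ex_minnP => i /andP[].
have le_jk : (j <= k.-1)%N.
  by apply: minj; rewrite prednK ?mk1 ?addn0 ?le_D; lia.
have lt_Dj : (D < m j + m j.+1)%N.
  case: (j) j_gt0 minj => [//|[|i]] _ minj //; rewrite ltnNge; apply/negP => H.
  by have := minj i.+1; rewrite H => /(_ isT); rewrite ltnn.
have N_gt0 : (0 < m j.+1)%N by apply: m_gt0; lia.
(* The number of whole blocks above [D]; the 1 accounts for the open upper end. *)
pose q := ((m j + m j.+1 - 1 - D) %/ m j.+1)%N.
have := divn_eq (m j + m j.+1 - 1 - D) (m j.+1); rewrite -/q => Eq.
have := ltn_pmod (m j + m j.+1 - 1 - D) N_gt0 => lt_mod.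
exists j, q; split; [lia | lia | lia |].
have := @euclid_eq j; nia.
Qed.

(** Blocks of one [j] are disjoint, and by [euclid_sum_anti] those of a larger [j] lie below. *)
Lemma euclid_window_unique D j q j' q' :
  euclid_window D j q -> euclid_window D j' q' -> j = j' /\ q = q'.
Proof.
suff lt_absurd i r i' r' : euclid_window D i r -> euclid_window D i' r' ->
    (i < i')%N || ((i == i') && (r < r')%N) -> False.
  move=> w w'; case: (ltngtP j j') => [lt_j|lt_j|Ej].
  - by case: (lt_absurd _ _ _ _ w w'); rewrite lt_j.
  - by case: (lt_absurd _ _ _ _ w' w); rewrite lt_j.
  subst j'; split=> //; case: (ltngtP q q') => [lt_q|lt_q|//].
  - by case: (lt_absurd _ _ _ _ w w'); rewrite eqxx lt_q orbT.
  - by case: (lt_absurd _ _ _ _ w' w); rewrite eqxx lt_q orbT.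
move=> [le1 lt1 iP rP] [le2 lt2 i'P r'P] /orP[lt_i|/andP[/eqP Ei lt_r]].
  have S : (m i' + m i'.+1 <= m i.+1 + m i.+2)%N by apply: euclid_sum_anti; lia.
  have := euclid_eq iP; nia.
subst i'; nia.
Qed.

Variables (l : nat) (vp : X).
Hypothesis init : exists f1 f2, overlap (gam 1%N) (gam 2%N) f1 f2 (m 1) (m 2) l /\ f1 0 = vp.

Let Gam := generated [set gam 1%N; gam 2%N].

(** The equation on [L] is the invariance of D = m_1 + m_2 - l, written without subtraction. *)
Definition euclid_state j q :=
  exists f1 f2 L, [/\
    overlap (gam j * gam j.+1 ^- q)%g (gam j.+1) f1 f2 (m j - q * m j.+1) (m j.+1) L,
    (L + m 1 + m 2 + q * m j.+1 = l + m j + m j.+1)%N, f1 0 = vp &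
    Gam = generated [set (gam j * gam j.+1 ^- q)%g; gam j.+1]].

(** The last hypothesis says that the overlap at [(j, q)] is positive; so at every earlier stage it
    exceeds the shorter translation length and [overlap_step] applies. *)
Lemma euclid_stateP j q : (1 <= j <= k.-1)%N -> (q < qs j)%N ->
  (m 1 + m 2 + q * m j.+1 < l + m j + m j.+1)%N -> euclid_state j q.
Proof.
have gamE i : (1 <= i <= k.-1)%N -> (gam i.+2 = gam i * gam i.+1 ^- qs i)%g.
  by case: eucl => _ _ rec /rec[].
have step i r : (1 <= i <= k.-1)%N -> (r < qs i)%N -> euclid_state i r ->
    (m i.+1 < m i - r * m i.+1)%N ->
    (m 1 + m 2 + r.+1 * m i.+1 < l + m i + m i.+1)%N ->
    exists f1 f2 L, [/\
    overlap (gam i * gam i.+1 ^- r.+1)%g (gam i.+1) f1 f2 (m i - r.+1 * m i.+1) (m i.+1) L,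
    (L + m 1 + m 2 + r.+1 * m i.+1 = l + m i + m i.+1)%N, f1 0 = vp &
    Gam = generated [set (gam i * gam i.+1 ^- r.+1)%g; gam i.+1]].
  move=> iP lt_r [f1 [f2 [L [ov EL f10 EG]]]] lt_N lt_L.
  have lt_NL : (m i.+1 < L)%N by lia.
  have [f3 [ov3 f3E]] := overlap_step ov lt_N lt_NL.
  exists f3, f2, (L - m i.+1)%N; rewrite expgN_S in ov3.
  split; [|lia|by rewrite f3E|by rewrite EG generated2_div expgN_S].
  by have -> : (m i - r.+1 * m i.+1 = m i - r * m i.+1 - m i.+1)%N by lia.
elim: j q => [//|j IHj]; elim=> [|q IHq] jP lt_q ltL; last first.
  have st : euclid_state j.+1 q by apply: IHq => //; nia.
  have N_gt0 : (0 < m j.+2)%N by apply: m_gt0; lia.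
  have le_q : (q.+2 * m j.+2 <= qs j.+1 * m j.+2)%N by rewrite leq_mul2r lt_q orbT.
  by apply: (step _ _ jP _ st) => //; have := euclid_eq jP; lia.
case: j IHj jP lt_q ltL => [_ _ _ _|j IHj jP lt_q ltL].
  have [f1 [f2 [ov f10]]] := init; exists f1, f2, l.
  by rewrite expg0 invg1 mulg1 mul0n subn0 addn0; split.
have jP' : (1 <= j.+1 <= k.-1)%N by lia.
have q_gt0 := euclid_quot_gt0 jP'.
have lt_m := euclid_lt jP'.
(* A positive remainder makes the inequality before the last subtraction of this quotient strict. *)
have m3_gt0 : (0 < m j.+3)%N by apply: m_gt0; lia.
have Ej := euclid_eq jP'.
have [||||f1 [f2 [L]]] := step j.+1 (qs j.+1).-1 jP'.
- lia.
- by apply: IHj => //; nia.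
- by nia.
- by rewrite prednK //; nia.
rewrite prednK // -gamE // -mE // => -[ov EL f10 EG].
(* The remainder is now the shorter length, so the two generators exchange roles. *)
exists f2, f1, L; rewrite expg0 invg1 mulg1 mul0n subn0 addn0; split.
- exact: overlap_sym.
- nia.
- by have [_ _ E _ _] := ov; rewrite -E // lexx andbT oppr_le0.
- by rewrite EG setUC.
Qed.

End Euclid.

(** * The three cases, separated by the length of the overlap *)

Theorem theorem3p3 (X : tree) (gam : nat -> aut X) (m qs : nat -> nat)
    (k l : nat) (vm vp : X) :
  locally_finite X ->
  hyperbolic (gam 1%N) -> hyperbolic (gam 2%N) ->
  m 1%N = translation_length (gam 1%N) -> m 2%N = translation_length (gam 2%N) ->
  (0 < m 2 <= m 1)%N ->
  let Gam : set (aut X) := generated [set gam 1%N; gam 2%N] in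
  discrete Gam -> without_inversions Gam ->
  let A1 := axis (gam 1%N) in
  let A2 := axis (gam 2%N) in
  ell (A1 `&` A2) = (l%:R)%:E ->
  (~ edge_disjoint A1 A2 ->
    [/\ A1 `&` A2 = segment vm vp,
        translates_toward (gam 1%N) vm vp &
        translates_toward (gam 2%N) vm vp]) ->
  euclidean_sequences k m qs gam ->
  let bound (j : nat) (q : int) : int :=
    (m 1%N)%:Z + (m 2%N)%:Z - (m j)%:Z + q * (m j.+1)%:Z in
  let window (j q : nat) : Prop :=
    [/\ bound j (q%:Z - 1) < l%:Z <= bound j q%:Z,
        (1 <= j <= k - 1)%N & q%:Z <= (qs j)%:Z - 1] in
  exactly_one_of_three
    (* case (1) *)
    (l = 0%N /\
      (is_free_of_rank 2%N Gam /\
       exists a b : aut X, [/\ schottky_pair a b, Gam = generated [set a; b] &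
         edge_disjoint (axis a) (axis b)]))
    (* case (2) *)
    ((0 < l <= m 1 + m 2 - gcdn (m 1) (m 2))%N /\
      ((exists! jq : nat * nat, window jq.1 jq.2) /\
       forall j q : nat, window j q ->
         (* case (2a) *)
         (l%:Z = bound j q%:Z ->
           let h : aut X := (gam j * gam j.+1 ^- q)%g in
           let l0 := ell (axis h `&` gam j.+1 @` axis h) in
           let r : rat := ((m j)%:R - (q.+1)%:R * (m j.+1)%:R) / 2 in
           [/\ hyperbolic h,
               ((r%:E <= l0)%E ->
                 ~ is_free Gam /\
                 exists a b : aut X,
                   [/\ hyperbolic a, elliptic b, Gam = generated [set a; b] &
                     edge_disjoint (axis a) (fixed_subtree b)]) &
               ((l0 < r%:E)%E ->
                 is_free_of_rank 2%N Gam /\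
                 exists a b : aut X,
                   [/\ schottky_pair a b, Gam = generated [set a; b] &
                     edge_disjoint (axis a) (axis b)])]) /\
         (* case (2b) *)
         (l%:Z < bound j q%:Z ->
           is_free_of_rank 2%N Gam /\
           exists a b : aut X,
             [/\ schottky_pair a b, Gam = generated [set a; b],
                 ~ edge_disjoint (axis a) (axis b) &
                 endpoint vp (axis a `&` axis b)])))
    (* case (3) *)
    ((m 1 + m 2 - gcdn (m 1) (m 2) < l)%N /\
      (~ is_free Gam /\
       exists a b : aut X,
         [/\ hyperbolic a, elliptic b, Gam = generated [set a; b],
             ~ edge_disjoint (axis a) (fixed_subtree b) &
             endpoint vp (axis a `&` fixed_subtree b)])).
Proof.
move=> lfX hyp1 hyp2 m1E m2E m12 Gam discG noinv A1 A2 ellE dirs eucl bound window.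
have k_gt1 := euclid_k_gt1 m12 eucl.
have gcdE := euclid_gcd m12 eucl.
have mk_gt0 : (0 < m k)%N by case: eucl => + _ _; apply; lia.
have mk_le : (m k <= m 2)%N by rewrite -gcdE dvdn_leq ?dvdn_gcdr //; lia.
have [l0|l_gt0] := posnP l.
  apply: Or31; split; [|lia|lia].
  split=> //; have disj : edge_disjoint A1 A2 by apply/(ell_edge_disjoint ellE).
  have [f1 gf1] := hyperbolic_translates hyp1.
  have [f2 gf2] := hyperbolic_translates hyp2.
  have sch : schottky_pair (gam 1%N) (gam 2%N).
    apply: (schottky_disjoint_lines gf1 gf2); move: disj; rewrite /A1 /A2.
    by have [_ _ ->] := translates_axis gf1; have [_ _ ->] := translates_axis gf2.
  by split; [exact: schottky_free | exists (gam 1%N), (gam 2%N)].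
have ndisj : ~ edge_disjoint A1 A2 by move/(ell_edge_disjoint ellE); lia.
have [segE toward1 toward2] := dirs ndisj.
have init : exists f1 f2, overlap (gam 1%N) (gam 2%N) f1 f2 (m 1) (m 2) l /\ f1 0 = vp.
  by rewrite m1E m2E; apply: overlap_initial ellE segE _ _.
have state := euclid_stateP m12 eucl init.
have euclid_eq := euclid_eq eucl.
have noinvG a b : Gam = generated [set a; b] -> ~ inversion a.
  by move=> EG; apply: noinv; rewrite EG; apply: sub_generated; left.
have torsion a b : Gam = generated [set a; b] -> elliptic a -> a <> 1%g -> ~ is_free Gam.
  move=> EG ella a1; rewrite EG in discG *; apply: elliptic_not_free discG _ ella a1 => //.
  by apply: sub_generated; left.
have free2 a b : Gam = generated [set a; b] -> schottky_pair a b -> is_free_of_rank 2 Gam.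
  by move=> -> /schottky_free.
rewrite gcdE; have [le_l|lt_l] := leqP l (m 1%N + m 2%N - m k).
  apply: Or32; split; [lia | | lia]; split=> //.
  (* In this case [l] is below [m 1 + m 2], so the subtraction of naturals is exact. *)
  have windowP j q : window j q <-> euclid_window m qs k (m 1%N + m 2%N - l) j q.
    by rewrite /window /bound /euclid_window; split=> -[]; split; lia.
  split.
    have [||j [q jqP]] := @euclid_window_exists _ _ _ _ _ m12 eucl (m 1%N + m 2%N - l); [lia..|].
    exists (j, q); split; first exact/windowP.
    move=> [j' q'] /windowP /= j'q'P.
    by have [-> ->] := euclid_window_unique m12 eucl jqP j'q'P.
  move=> j q /windowP[le_D lt_D jP lt_q].
  have [|f1 [f2 [L [ov EL f10 EG]]]] := state j q jP lt_q; first lia.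
  have Ej := euclid_eq _ jP.
  have le_q : (q.+1 * m j.+1 <= qs j * m j.+1)%N by rewrite leq_mul2r lt_q orbT.
  have [af bf _ _ _] := ov; split=> [lE|lt_lb] /=; last first.
    (* The strict inequality means that the current overlap is shorter than both translation
       lengths. *)
    have L_gt0 : (0 < L)%N by lia.
    have sch : schottky_pair (gam j * gam j.+1 ^- q)%g (gam j.+1).
      by apply: (overlap_schottky ov); rewrite /bound in lt_lb; lia.
    split; first exact: free2 EG sch.
    exists (gam j * gam j.+1 ^- q)%g, (gam j.+1); split=> //.
      exact: overlap_shared_edge ov L_gt0.
    by rewrite -f10; apply: overlap_endpoint ov L_gt0.
  (* Equality in the window is the boundary case. *)
  have LE : L = m j.+1 by rewrite /bound in lE; lia.
  pose p := (m j - q.+1 * m j.+1)%N.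
  have pE : (m j - q * m j.+1 = p + m j.+1)%N by lia.
  have rE : ((m j)%:R - q.+1%:R * (m j.+1)%:R) / 2 = p%:R / 2 :> rat.
    by rewrite /p natrB ?natrM //; lia.
  rewrite LE pE in ov; rewrite rE; have {}EG := etrans EG (generated2_div _ _).
  split; first by have [] := translates_axis af.
  - move=> /(abutting_elliptic ov)[]; first exact: noinvG EG.
    move=> ella a1 disj; split; first exact: torsion EG ella a1.
    exists (gam j.+1), (gam j * gam j.+1 ^- q * (gam j.+1)^-1)%g; split=> //.
      by have [] := translates_axis bf.
    by rewrite setUC; exact: EG.
  - move=> /(abutting_hyperbolic ov)[sch disj]; split; first exact: free2 EG sch.
    by exists (gam j * gam j.+1 ^- q * (gam j.+1)^-1)%g, (gam j.+1); split.
apply: Or33; split; [lia | lia |]; split=> //.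
(* The algorithm is run to its last pair, [j = k.-1] and [q = (qs k.-1).-1], where both translation
   lengths are [m k] and the overlap is still longer. *)
have jP : (1 <= k.-1 <= k.-1)%N by lia.
have q_gt0 := euclid_quot_gt0 m12 eucl jP.
have Ek := euclid_eq _ jP; have mk1 : m k.+1 = 0%N by case: eucl.
rewrite prednK ?mk1 ?addn0 in Ek; last lia.
have Eq : ((qs k.-1).-1 * m k + m k = m k.-1)%N.
  by rewrite Ek -[in RHS](prednK q_gt0) mulSn addnC.
have [||f1 [f2 [L [+ EL f10 EG]]]] := state k.-1 (qs k.-1).-1 jP; first lia.
  by rewrite prednK; lia.
rewrite prednK in EL EG *; last lia.
rewrite (_ : (m k.-1 - _)%N = m k) => [ov|]; last lia.
have lt_kL : (m k < L)%N by lia.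
have [_ bf _ _ _] := ov.
have [ella a1 ndisj' endp] := overlap_elliptic ov lt_kL.
have {}EG := etrans EG (generated2_div _ _); split; first exact: torsion EG ella a1.
exists (gam k), (gam k.-1 * gam k ^- (qs k.-1).-1 * (gam k)^-1)%g; split=> //.
- by have [] := translates_axis bf.
- by rewrite setUC; exact: EG.
- by rewrite -f10.
Qed.
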